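(* Let $n\ge m+2$. There exists an open, dense subset $\Omega$ of $(\mathbb{R}^m)^n$ such that if an $n$-point configuration $p_1,\ldots,p_n\in\mathbb{R}^m$ (with points not all equal) satisfies $(p_1,\ldots,p_n)\in\Omega$, then $p_1,\ldots,p_n$ is uniquely determined, up to rotations, translations, reflections, scalings and relabeling of the points, by the distribution of its rescaled pairwise distances $\left\{\frac{d_{\{i,j\}}}{d_{max}}\right\}$, where $\{i,j\}$ ranges over all two-element subsets of $\{1,\ldots,n\}$. Moreover, there is an algorithm in $O\left(n^{\frac{m^2+3m+12}{2}}\right)$ steps to determine whether $(p_1,\ldots,p_n)\in\Omega$.
   Context: An $n$-point configuration is a collection of $n$ points $p_1,\ldots,p_n$ in $\mathbb{R}^m$. For such a configuration, let $d_{\{i,j\}}=\|p_i-p_j\|^2$ for every two-element subset $\{i,j\}$ of $\{1,\ldots,n\}$, and let $d_{max}$ be the maximum of all the $d_{\{i,j\}}$, which is non-zero when the points do not all coincide. The distribution of the rescaled pairwise distances is the list of the different values of the numbers $d_{\{i,j\}}/d_{max}$ together with the number of times each value occurs, i.e. the multiset of these numbers. A scaling is a map $p_i\mapsto\lambda p_i$ for every $i=1,\ldots,n$, with $\lambda\in\mathbb{R}\setminus\{0\}$. ''Uniquely determined up to rotations, translations, reflections, scalings and relabeling'' means: for every $q_1,\ldots,q_n\in\mathbb{R}^m$ (not all equal) with the same distribution of rescaled pairwise distances as $p_1,\ldots,p_n$, there exist an orthogonal $m\times m$ matrix $M$, a vector $T\in\mathbb{R}^m$, a scalar $\lambda\in\mathbb{R}\setminus\{0\}$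 and a permutation $\pi$ of $\{1,\ldots,n\}$ such that $\lambda(Mp_i+T)=q_{\pi(i)}$ for all $i=1,\ldots,n$. *)

(* Defs.v *)
From mathcomp Require Import all_boot all_order all_fingroup all_algebra.
From mathcomp Require Import boolp classical_sets reals topology normedtype.

Set Implicit Arguments.
Unset Strict Implicit.
Unset Printing Implicit Defensive.

Import Order.TTheory GRing.Theory Num.Theory.
Import numFieldNormedType.Exports.

Local Open Scope ring_scope.

(* An n-point configuration in R^m is an m x n matrix whose columns are the
   points, so that the library's topology on ['M[R]_(m, n)] is the usual
   topology of (R^m)^n. *)
Section Configurations.
Variables (R : realType) (m n : nat).
Implicit Types p q : 'M[R]_(m, n).

(* The norm on R^m is Euclidean, whereas the library's norm on matrices
   is the sup norm; hence the explicit sum of squares. *)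
Definition sqdist p (i j : 'I_n) : R := \sum_(k < m) (p k i - p k j) ^+ 2.

(* A two-element subset {i, j} is encoded as the ordered pair with i < j. *)
Definition pairs : {pred 'I_n * 'I_n} := [pred ij : 'I_n * 'I_n | (ij.1 < ij.2)%N].

(* The default value 0 is harmless: squared distances are nonnegative. *)
Definition dmax p : R := \big[Num.max/0]_(ij in pairs) sqdist p ij.1 ij.2.

(* To be compared up to [perm_eq], i.e., as a multiset. *)
Definition rescaled_distances p : seq R :=
  [seq sqdist p ij.1 ij.2 / dmax p | ij in pairs].

Definition not_all_equal p : Prop := exists i j, col i p <> col j p.

Definition same_up_to_similarity_and_relabeling p q : Prop :=
  exists (M : 'M[R]_m) (T : 'cV[R]_m) (lambda : R) (pi : 'S_n),
    [/\ M^T *m M = 1%:M, lambda != 0 &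
        forall i, lambda *: (M *m col i p + T) = col (pi i) q].

Definition determined_by_rescaled_distances p : Prop :=
  forall q, not_all_equal q ->
    perm_eq (rescaled_distances p) (rescaled_distances q) ->
    same_up_to_similarity_and_relabeling p q.

End Configurations.

(* Algorithms are programs for a real RAM. A program is finite syntax without
   real constants other than 0 and 1. It acts on two unbounded memories, one of
   natural numbers and one of reals, whose cells are addressed by computed
   natural numbers. Every arithmetic operation, comparison, constant, memory
   access and [Skip] is one step. There is no conversion between the two sorts
   of numbers and no multiplication of natural numbers. *)
Inductive iexp :=
  | IConst of nat
  | ILoad of iexp
  | IAdd of iexp & iexp
  | ISub of iexp & iexp.

Inductive rexp :=
  | RZero
  | ROne
  | RLoad of iexp
  | RAdd of rexp & rexp
  | RSub of rexp & rexp
  | RMul of rexp & rexp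
  | RDiv of rexp & rexp.

Inductive test :=
  | IEq of iexp & iexp
  | ILt of iexp & iexp
  | REq of rexp & rexp
  | RLt of rexp & rexp.

Inductive program :=
  | Skip
  | IStore of iexp & iexp
  | RStore of iexp & rexp
  | Seq of program & program
  | If of test & program & program
  | While of test & program.

Fixpoint icost (e : iexp) : nat :=
  match e with
  | IConst _ => 1
  | ILoad a => (icost a).+1
  | IAdd e1 e2 | ISub e1 e2 => (icost e1 + icost e2).+1
  end.

Fixpoint rcost (e : rexp) : nat :=
  match e with
  | RZero | ROne => 1
  | RLoad a => (icost a).+1
  | RAdd e1 e2 | RSub e1 e2 | RMul e1 e2 | RDiv e1 e2 =>
      (rcost e1 + rcost e2).+1
  end.

Definition tcost (b : test) : nat :=
  match b with
  | IEq e1 e2 | ILt e1 e2 => (icost e1 + icost e2).+1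
  | REq e1 e2 | RLt e1 e2 => (rcost e1 + rcost e2).+1
  end.

Section Semantics.
Variable R : realType.

Record state := State { imem : nat -> nat; rmem : nat -> R }.

(* Subtraction of natural numbers is truncated. *)
Fixpoint ieval (s : state) (e : iexp) : nat :=
  match e with
  | IConst c => c
  | ILoad a => imem s (ieval s a)
  | IAdd e1 e2 => (ieval s e1 + ieval s e2)%N
  | ISub e1 e2 => (ieval s e1 - ieval s e2)%N
  end.

(* Division by 0 returns 0. *)
Fixpoint reval (s : state) (e : rexp) : R :=
  match e with
  | RZero => 0
  | ROne => 1
  | RLoad a => rmem s (ieval s a)
  | RAdd e1 e2 => reval s e1 + reval s e2
  | RSub e1 e2 => reval s e1 - reval s e2
  | RMul e1 e2 => reval s e1 * reval s e2
  | RDiv e1 e2 => reval s e1 / reval s e2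
  end.

Definition teval (s : state) (b : test) : bool :=
  match b with
  | IEq e1 e2 => ieval s e1 == ieval s e2
  | ILt e1 e2 => (ieval s e1 < ieval s e2)%N
  | REq e1 e2 => reval s e1 == reval s e2
  | RLt e1 e2 => reval s e1 < reval s e2
  end.

Definition istore (s : state) (a v : nat) : state :=
  State [eta imem s with a |-> v] (rmem s).

Definition rstore (s : state) (a : nat) (v : R) : state :=
  State (imem s) [eta rmem s with a |-> v].

(* [exec c s s' t]: started in state s, the program c halts in state s' after
   exactly t steps. *)
Inductive exec : program -> state -> state -> nat -> Prop :=
  | exec_Skip s : exec Skip s s 1
  | exec_IStore s a e :
      exec (IStore a e) s (istore s (ieval s a) (ieval s e))
        (icost a + icost e).+1
  | exec_RStore s a e :
      exec (RStore a e) s (rstore s (ieval s a) (reval s e))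
        (icost a + rcost e).+1
  | exec_Seq c1 c2 s s1 s2 t1 t2 :
      exec c1 s s1 t1 -> exec c2 s1 s2 t2 -> exec (Seq c1 c2) s s2 (t1 + t2)
  | exec_If b c1 c2 s s1 t :
      exec (if teval s b then c1 else c2) s s1 t ->
      exec (If b c1 c2) s s1 (tcost b + t)
  | exec_While_stop b c s :
      ~~ teval s b -> exec (While b c) s s (tcost b)
  | exec_While_step b c s s1 s2 t1 t2 :
      teval s b -> exec c s s1 t1 -> exec (While b c) s1 s2 t2 ->
      exec (While b c) s s2 (tcost b + t1 + t2).

(* The number n of points is stored in cell 0 of the memory of naturals, and
   coordinate k of point i in cell i * m + k of the memory of reals; all other
   cells contain 0. *)
Definition input (m n : nat) (p : 'M[R]_(m, n)) : state :=
  State [eta (fun=> 0%N) with 0%N |-> n]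
        (nth 0 [seq p k i | i <- enum 'I_n, k <- enum 'I_m]).

(* The answer, 1 for "yes" and 0 for "no", is left in cell 0 of the memory of
   naturals. *)
Definition decides_within (P : program) (m n : nat)
    (Omega : set 'M[R]_(m, n)) (T : nat) : Prop :=
  forall p : 'M[R]_(m, n), exists (s : state) (t : nat),
    [/\ exec P (input p) s t, (t <= T)%N &
        imem s 0 = nat_of_bool `[< Omega p >]].

End Semantics.

(* Main.v *)
Require Import Defs.
From mathcomp Require Import all_boot all_order all_fingroup all_algebra.
From mathcomp Require Import boolp classical_sets reals topology normedtype.
From mathcomp Require Import zify ring lra.

Set Implicit Arguments.
Unset Strict Implicit.
Unset Printing Implicit Defensive.

Import Order.TTheory GRing.Theory Num.Theory.
Import numFieldNormedType.Exports.

Local Open Scope ring_scope.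

(* The m + 2 points of a configuration in R^m satisfy one relation, the vanishing
   of a Gram determinant in their squared distances. If q has the same rescaled
   distances as p, then an assignment of edges of p to the edges of the complete
   graph on m + 2 points of q makes this determinant vanish. Unless the
   assignment maps triangles to triangles, i.e., is induced by a map of the
   points, this is a nontrivial polynomial condition on p. So for generic p all
   such assignments are induced, and q is congruent to p up to scaling.

   To check genericity fast enough, one need not consider all assignments. By a
   packing argument, among the O(n) shortest edges of q there are those of a
   complete graph on m + 2 points. They come from the O(n) shortest edges of p,
   so that n^C(m+2,2) assignments suffice to recover a congruent copy of m + 2
   points of q inside p. Every further point of q is recovered from its distances
   to m + 1 of these, for which one considers the assignments that are induced on
   m + 1 points and arbitrary on the edges to the last one; there are at most
   n^(3m+3) of them. Both exponents are at most (m^2 + 3m + 12) / 2. *)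

(** * Gram matrices of squared distances *)

(** Two obstacles shape the proof. The conditions imposed on [p] vary with [p], because short
    assignments are defined by the ranks of its edges; openness therefore rests on a semicontinuity
    of ranks, while density is proved for all assignments at once. Moreover, an assignment that
    breaks a triangle may hit an arbitrary graph, and a configuration with nonzero determinant must
    still be found in dimension [m]. The number of edges is just right for this: with one edge
    contracted, fewer than ['C(m.+2, 2)] remain, so [m.+1] colours suffice, as many as a regular
    simplex has vertices. Triangles have to be respected as triangles: three pairwise meeting edges
    may also form a star, and on four points the exchange of opposite edges turns triangles into
    stars. *)

Definition gram (R : ringType) (I : Type) k (y : I -> I -> R) (o : I)
    (f : 'I_k -> I) : 'M[R]_k :=
  \matrix_(i, j) (y o (f i) + y o (f j) - y (f i) (f j)).

Section GramKernel.
Variable R : realFieldType.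

(** Completing a kernel vector [u] by minus its sum at [ord0] gives [x] of sum zero; entry [j] of
    [u G = 0] then says that [y x] agrees at [ord0] and [lift ord0 j]. In this form no vertex is
    distinguished. *)
Lemma gram_kernel k (y : 'I_k.+1 -> 'I_k.+1 -> R) :
  (forall i j, y i j = y j i) -> (forall i, y i i = 0) ->
  \det (gram y ord0 (lift ord0)) = 0 ->
  exists x : 'I_k.+1 -> R, [/\ exists i, x i != 0, \sum_i x i = 0 &
    forall i j, \sum_l y i l * x l = \sum_l y j l * x l].
Proof.
move=> ysym y0 /eqP/det0P[u u0 uG].
pose x i := if unlift ord0 i is Some j then u 0 j else - \sum_j u 0 j.
have x0 : x ord0 = - \sum_j u 0 j by rewrite /x unlift_none.
have xl j : x (lift ord0 j) = u 0 j by rewrite /x liftK.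
have sx : \sum_i x i = 0.
  rewrite big_ord_recl x0; under [X in _ + X]eq_bigr do rewrite xl.
  exact: addNr.
have key i : \sum_l y i l * x l = \sum_l y ord0 l * x l.
  case: (unliftP ord0 i) => [j|] -> //.
  have /matrixP/(_ 0 j) := uG; rewrite !mxE => uGj.
  apply/eqP; rewrite -subr_eq0 -oppr_eq0; apply/eqP; rewrite -[RHS]uGj.
  rewrite opprB -sumrB big_ord_recl y0 mul0r x0 (ysym _ ord0).
  under [X in _ + X]eq_bigr do rewrite xl.
  rewrite [RHS](eq_bigr (fun l => u 0 l * y ord0 (lift ord0 j) +
     (y ord0 (lift ord0 l) * u 0 l - y (lift ord0 j) (lift ord0 l) * u 0 l))); last first.
    by move=> l _; rewrite !mxE (ysym (lift ord0 j)); ring.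
  rewrite [RHS]big_split /=; congr (_ + _); rewrite -mulr_suml; ring.
exists x; split => //; last by move=> i j; rewrite !key.
case/rV0Pn: u0 => j uj; exists (lift ord0 j); by rewrite xl.
Qed.

(* With the two endpoints of a zero edge merged, the remaining lengths are
   close to constant, hence definite on the vectors of sum zero; a vector in
   the kernel is then supported on the two merged vertices. *)
Lemma collapsed_gram k (y : 'I_k.+1 -> 'I_k.+1 -> R) i0 j0 k0 eps :
  (forall i j, y i j = y j i) -> (forall i, y i i = 0) -> 0 <= eps ->
  i0 != j0 -> y i0 j0 = 0 ->
  (forall i j, i != j -> ~~ ((i == i0) && (j == j0)) ->
     ~~ ((i == j0) && (j == i0)) -> `|y i j - 2| <= eps) ->
  k.+1%:R * eps < 2 -> y k0 i0 != y k0 j0 ->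
  \det (gram y ord0 (lift ord0)) != 0.
Proof.
move=> ysym y0 eps0 ij0 y00 yeps keps; apply: contra_neq => detG.
have [x [[i1 xi1] sx yx]] := gram_kernel ysym y0 detG.
(* [z] is [x] with the weight of [j0] moved onto [i0]; the two differ by [x j0] times [v], which is
   1 at [j0] and -1 at [i0]. *)
pose z i := if i == j0 then 0 else if i == i0 then x i0 + x j0 else x i.
have zj0 : z j0 = 0 by rewrite /z eqxx.
pose v i : R := if i == j0 then 1 else if i == i0 then -1 else 0.
have xE i : x i = z i + x j0 * v i.
  rewrite /z /v; case: eqP => [->|_]; first by ring.
  by case: eqP => [->|_]; ring.
have sv (F : 'I_k.+1 -> R) : \sum_i F i * v i = F j0 - F i0.
  rewrite (bigD1 j0) //= (bigD1 i0) //= /v eqxx (negPf ij0) eqxx big1 ?addr0.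
    by ring.
  by move=> i /andP[/negPf-> /negPf->]; rewrite mulr0.
have sz : \sum_i z i = 0.
  have := sx; under eq_bigr do rewrite xE.
  rewrite big_split /= -mulr_sumr.
  have -> : \sum_i v i = 0.
    by rewrite -[RHS](subrr 1) -(sv (fun=> 1)); apply: eq_bigr => i _; rewrite mul1r.
  by rewrite mulr0 addr0.
pose Yx := \sum_l y ord0 l * x l.
have Yv i : \sum_l y i l * v l = y i j0 - y i i0 by rewrite sv.
have Yz i : \sum_l y i l * z l = Yx - x j0 * (y i j0 - y i i0).
  rewrite -Yv mulr_sumr /Yx (yx ord0 i) -sumrB; apply: eq_bigr => l _.
  by rewrite (xE l); ring.
have zYv : \sum_i z i * (y i j0 - y i i0) = 0.
  under eq_bigr do rewrite mulrBr.
  rewrite sumrB (eq_bigr (fun i => y j0 i * z i)); last first.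
    by move=> i _; rewrite mulrC ysym.
  rewrite [X in _ - X](eq_bigr (fun i => y i0 i * z i)); last first.
    by move=> i _; rewrite mulrC ysym.
  by rewrite !Yz !y0 y00 (ysym j0) y00; ring.
(* [z] has sum zero and is orthogonal to [Y v], whereas [Y z] is a constant minus [x j0] times
   [Y v]. *)
have zYz : \sum_i z i * (\sum_l y i l * z l) = 0.
  under eq_bigr do rewrite Yz mulrBr.
  rewrite sumrB -mulr_suml sz mul0r.
  rewrite (eq_bigr (fun i => x j0 * (z i * (y i j0 - y i i0)))); last first.
    by move=> i _; ring.
  by rewrite -mulr_sumr zYv mulr0 subrr.
pose Q := \sum_i z i ^+ 2.
(* On vectors of sum zero the constant length 2 contributes minus twice the squared norm; the double
   sum measures the deviation from 2. *)
have zYzE : \sum_i z i * (\sum_l y i l * z l) =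
   - (2 * Q) + \sum_i \sum_(l | l != i) (y i l - 2) * z i * z l.
  have -> : - (2 * Q) = \sum_i \sum_(l | l != i) 2 * z i * z l.
    rewrite /Q mulr_sumr -sumrN; apply: eq_bigr => i _.
    rewrite -mulr_sumr.
    have -> : \sum_(l | l != i) z l = - z i.
      have := sz; rewrite (bigD1 i) //= => /eqP.
      by rewrite addrC addr_eq0 => /eqP.
    by ring.
  rewrite -big_split /=; apply: eq_bigr => i _.
  rewrite -big_split /= mulr_sumr (bigD1 i) //= y0 mul0r mulr0 add0r.
  by apply: eq_bigr => l _; ring.
have Q0 : Q = 0.
  have Qge : 0 <= Q by apply: sumr_ge0 => i _; exact: sqr_ge0.
  have bnd : \sum_i \sum_(l | l != i) (y i l - 2) * z i * z l <=
             k.+1%:R * eps * Q.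
    have -> : k.+1%:R * eps * Q =
       \sum_i \sum_l eps * ((z i ^+ 2 + z l ^+ 2) / 2).
      have e1 : \sum_i \sum_(l < k.+1) z i ^+ 2 = k.+1%:R * Q.
        under eq_bigr do rewrite sumr_const card_ord.
        by rewrite sumrMnl [RHS]mulr_natl.
      have e2 : \sum_(i < k.+1) \sum_l z l ^+ 2 = k.+1%:R * Q.
        by rewrite sumr_const card_ord [RHS]mulr_natl.
      transitivity (\sum_i \sum_l (eps / 2 * (z i ^+ 2) + eps / 2 * (z l ^+ 2))).
        under eq_bigr do rewrite big_split -2!(mulr_sumr _ _ _ (eps / 2)).
        by rewrite big_split -2!(mulr_sumr _ _ _ (eps / 2)) /= e1 e2; field.
      by apply: eq_bigr => i _; apply: eq_bigr => l _; field.
    apply: ler_sum => i _.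
    rewrite [leRHS](bigD1 i) //= -[leLHS]add0r lerD //.
      by rewrite mulr_ge0 // divr_ge0 // addr_ge0 ?sqr_ge0.
    apply: ler_sum => l li.
    have rhs0 : 0 <= eps * ((z i ^+ 2 + z l ^+ 2) / 2).
      by rewrite mulr_ge0 // divr_ge0 // addr_ge0 ?sqr_ge0.
    have [lj|lj] := eqVneq l j0; first by move: rhs0; rewrite lj zj0 mulr0.
    have [ij|ij] := eqVneq i j0; first by move: rhs0; rewrite ij zj0 mulr0 mul0r.
    have := yeps i l; rewrite eq_sym li (negPf lj) (negPf ij) !andbF => /(_ isT isT isT) yil.
    apply: le_trans (ler_norm _) _; rewrite -mulrA normrM.
    apply: ler_pM => //; have := sqr_ge0 (`|z i| - `|z l|).
    by rewrite normrM -(real_normK (num_real (z i))) -(real_normK (num_real (z l))); lra.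
  have : 0 <= (2 - k.+1%:R * eps) * Q <= 0.
    by apply/andP; split; [apply: mulr_ge0 => //; lra | move: bnd zYzE; rewrite zYz; lra].
  by rewrite -eq_le eq_sym mulf_eq0 subr_eq0 => /orP[/eqP|/eqP]; lra.
have z0 i : z i = 0.
  have /psumr_eq0P := Q0; move=> /(_ (fun i _ => sqr_ge0 (z i)) i isT) /eqP.
  by rewrite sqrf_eq0 => /eqP.
have xj0 : x j0 != 0.
  by apply: contra_neq xi1 => xj; rewrite xE z0 xj mul0r addr0.
have Yc i : \sum_l y i l * x l = x j0 * (y i j0 - y i i0).
  by rewrite -Yv mulr_sumr; apply: eq_bigr => l _; rewrite (xE l) z0; ring.
(* [y x] vanishes at [i0], hence also at [k0], where it is [x j0 * (y k0 j0 - y k0 i0)]. *)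
have := yx k0 i0; rewrite !Yc y00 y0 subrr mulr0 => /eqP.
by rewrite mulf_eq0 (negPf xj0) /= subr_eq0 => /eqP.
Qed.

End GramKernel.

(** * Colourings and the regular simplex *)

(* Two colour classes without an edge between them can be merged, so a graph
   with fewer than ['C(m.+2, 2)] edges never needs more than [m.+1] colours. *)
Lemma few_edges_colorable m k (es : seq ('I_k * 'I_k)) :
  all (fun e => e.1 != e.2) es -> (size es < 'C(m.+2, 2))%N ->
  exists c : 'I_k -> 'I_m.+1, all (fun e => c e.1 != c e.2) es.
Proof.
elim: k es => [|k IHk] es es_neq es_lt.
  exists (fun=> ord0); by case: es es_neq {es_lt} => [|[[]]].
have [km|mk] := leqP k m.
  by exists (widen_ord (km : (k.+1 <= m.+1)%N)).
have [A A2 Aes] : exists2 A : {set 'I_k.+1}, #|A| = 2%N &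
    A \notin [seq [set e.1; e.2] | e <- es].
  apply/exists2P; apply: contrapT => /forallNP noA.
  suff: ('C(k.+1, 2) <= size es)%N.
    by apply/negP; rewrite -ltnNge (leq_trans es_lt) // leq_bin2l.
  rewrite -[X in binomial X _]card_ord -card_draws.
  rewrite -(size_map (fun e => [set e.1; e.2])) (leq_trans _ (card_size _)) //.
  apply/subset_leq_card/fintype.subsetP => A; rewrite inE => /eqP A2.
  by apply/negPn/negP => Aes; apply: (noA A).
have /cards2P[a [b [ab AE]]] : #|A| == 2%N by rewrite A2.
have [j aE] : exists j, a = lift b j.
  by case: (unliftP b a) ab => [j ->|->]; [exists j | rewrite eqxx].
(* [r] merges [b] into [a]; the ends of an edge stay different because [A] is not an edge. *)
pose r x := if unlift b x is Some y then y else j.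
have rP x y : r x = r y -> x != y -> [set x; y] = A.
  rewrite /r AE; case: (unliftP b x) => [x'|] ->; case: (unliftP b y) => [y'|] -> //.
  - by move=> ->; rewrite eqxx.
  - by move=> -> _; rewrite aE.
  - by move=> <- _; rewrite aE finset.setUC.
  - by rewrite eqxx.
have [||c /allP cP] := IHk [seq (r e.1, r e.2) | e <- es].
- rewrite all_map; apply/allP => e ees /=; apply/negP => /eqP re.
  have := rP _ _ re (allP es_neq _ ees) => eA.
  by move/negP: Aes; apply; rewrite -eA; apply/mapP; exists e.
- by rewrite size_map.
exists (c \o r); apply/allP => e ees.
by apply: (cP (r e.1, r e.2)); apply/mapP; exists e.
Qed.

Definition sqd (R : ringType) m (x y : 'I_m -> R) := \sum_k (x k - y k) ^+ 2.

(** The vertices are the standard basis vectors and the point with all coordinates [c]. All squared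
    distances are 2 once [m * c ^ 2 = 2 * c + 1], and [c] is the positive root of this equation. *)
Lemma regular_simplex (R : rcfType) m : (0 < m)%N ->
  exists s : 'I_m.+1 -> 'I_m -> R, forall a b, a != b -> sqd (s a) (s b) = 2.
Proof.
move=> m0; pose c : R := (1 + Num.sqrt (1 + m%:R)) / m%:R.
have m0' : (m%:R : R) != 0 by rewrite pnatr_eq0 -lt0n.
have cE : m%:R * c ^+ 2 = 2 * c + 1.
  have : Num.sqrt (1 + m%:R) ^+ 2 = 1 + m%:R :> R by rewrite sqr_sqrtr // addr_ge0.
  by rewrite /c => sE; field: sE.
pose s (a : 'I_m.+1) k : R := if unlift ord0 a is Some j then (k == j)%:R else c.
exists s.
have s0 j : sqd (s ord0) (s (lift ord0 j)) = 2.
  rewrite /sqd /s unlift_none liftK (bigD1 j) //= eqxx.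
  rewrite (eq_bigr (fun=> c ^+ 2)); last first.
    by move=> k /negPf->; rewrite subr0.
  rewrite sumr_const cardC1 card_ord -[_ *+ m.-1]mulr_natl -subn1 natrB // mulrBl cE /=; ring.
have sC a b : sqd (s a) (s b) = sqd (s b) (s a).
  by apply: eq_bigr => k _; rewrite -sqrrN opprB.
move=> a b; case: (unliftP ord0 a) => [i|] ->; case: (unliftP ord0 b) => [j|] -> //.
- rewrite (inj_eq lift_inj) => ij; rewrite /sqd /s !liftK (bigD1 i) //= (bigD1 j) 1?eq_sym //=.
  rewrite !eqxx (eq_sym j i) (negPf ij) big1 /= => [|k /andP[/negPf-> /negPf->]]; ring.
- by move=> _; rewrite sC.
Qed.

(** * Edges and triangles *)

Definition edge_eq (T : eqType) (e f : T * T) := (e == f) || (e == (f.2, f.1)).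

(** The third vertex is looked for among the ends of [f], which makes this a fixed boolean
    combination of equalities that a program can test. *)
Definition triangle (T : eqType) (e f g : T * T) :=
  has (fun c => edge_eq f (e.1, c) && edge_eq g (e.2, c)
             || edge_eq f (e.2, c) && edge_eq g (e.1, c)) [:: f.1; f.2].

Section Edges.
Variable T : eqType.
Implicit Types (a b c x y : T) (e f g : T * T).

Lemma edge_eqP e a b : reflect (e = (a, b) \/ e = (b, a)) (edge_eq e (a, b)).
Proof. by apply: (iffP orP) => -[/eqP|/eqP]; [left|right|left|right]. Qed.

Lemma edge_eq_refl e : edge_eq e e.
Proof. by rewrite /edge_eq eqxx. Qed.

Lemma edge_eqC e a b : edge_eq e (a, b) = edge_eq e (b, a).
Proof. by rewrite /edge_eq orbC. Qed.

Lemma edge_eq_sym e f : edge_eq e f = edge_eq f e.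
Proof.
by case: e f => [a b] [c d]; apply/edge_eqP/edge_eqP => -[[-> ->]|[-> ->]]; auto.
Qed.

Lemma edge_eq_trans e f g : edge_eq e f -> edge_eq f g -> edge_eq e g.
Proof.
case: e f g => [a b] [c d] [x y] /edge_eqP[[-> ->]|[-> ->]] //.
by move=> /edge_eqP[[-> ->]|[-> ->]]; apply/edge_eqP; auto.
Qed.

Lemma edge_eq_cancel e a x y : edge_eq e (a, x) -> edge_eq e (a, y) -> x = y.
Proof. by move=> /edge_eqP[->|->] /edge_eqP[[]|[]] // -> ->. Qed.

Lemma edge_eq_common e a b x y : a != b ->
  edge_eq e (a, x) -> edge_eq e (b, y) -> edge_eq e (a, b).
Proof.
move=> ab ex; rewrite edge_eq_sym => ey; have := edge_eq_trans ey ex.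
move=> /edge_eqP[[ba _]|[bx _]]; last by rewrite bx.
by rewrite ba eqxx in ab.
Qed.

Definition triangular e f g :=
  exists a b c, [/\ edge_eq e (a, b), edge_eq f (a, c) & edge_eq g (b, c)].

Lemma triangularCA e f g : triangular e f g -> triangular f e g.
Proof.
by move=> [a [b [c [? ? ?]]]]; exists a, c, b; split => //; rewrite edge_eqC.
Qed.

Lemma triangularAC e f g : triangular e f g -> triangular e g f.
Proof. by move=> [a [b [c [? ? ?]]]]; exists b, a, c; split; rewrite // edge_eqC. Qed.

Lemma triangular_eq e e' f g : edge_eq e e' -> triangular e f g -> triangular e' f g.
Proof.
move=> ee' [a [b [c [? ? ?]]]]; exists a, b, c; split => //.
by apply: edge_eq_trans (_ : edge_eq e _) => //; rewrite edge_eq_sym.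
Qed.

Lemma triangular_base a b f g : triangular (a, b) f g -> exists c,
  edge_eq f (a, c) /\ edge_eq g (b, c) \/ edge_eq f (b, c) /\ edge_eq g (a, c).
Proof. by move=> [x [y [c [/edge_eqP[[-> ->]|[-> ->]]]]]]; exists c; auto. Qed.

Lemma triangleP e f g : reflect (triangular e f g) (triangle e f g).
Proof.
apply: (iffP hasP) => [[c _ /orP[/andP[? ?]|/andP[? ?]]]|].
- by exists e.1, e.2, c; rewrite -surjective_pairing; split => //; exact: edge_eq_refl.
- exists e.2, e.1, c; split => //; apply/edge_eqP; right; exact: surjective_pairing.
case: e => a b /triangular_base[c fg]; exists c => /=; last first.
  by apply/orP; case: fg => -[-> ->]; auto.
by rewrite !inE; case: fg => -[/edge_eqP[->|->]] _; rewrite /= eqxx ?orbT.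
Qed.

Lemma third_edge u p q e f g : u != p -> p != q -> edge_eq e (u, p) -> edge_eq f (u, q) ->
  triangular e f g -> edge_eq g (p, q).
Proof.
move=> up pq ep fq /(triangular_eq ep)/triangular_base[c].
case=> -[fc gc]; first by rewrite (edge_eq_cancel fq fc).
have := edge_eq_trans (etrans (edge_eq_sym _ _) fq) fc.
case/edge_eqP => -[]; first by move=> up'; rewrite up' eqxx in up.
by move=> _ qp; rewrite qp eqxx in pq.
Qed.

Lemma triangle_apex b1 b2 b3 e1 e2 e3 : b2 != b3 -> ~~ edge_eq e1 (b2, b3) ->
  triangular (b1, b2) e1 e2 -> triangular (b1, b3) e1 e3 ->
  exists x, edge_eq e1 (b1, x).
Proof.
move=> b23 e1n /triangular_base[c [[? _]|[e1c _]]]; first by exists c.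
move=> /triangular_base[c' [[? _]|[e1c' _]]]; first by exists c'.
by rewrite (edge_eq_common b23 e1c e1c') in e1n.
Qed.

Lemma same_apex b1 b2 e1 e2 x1 x2 : b1 != b2 -> ~~ edge_eq e1 (b1, b2) ->
  edge_eq e1 (b1, x1) -> edge_eq e2 (b2, x2) -> triangular (b1, b2) e1 e2 ->
  x1 = x2.
Proof.
move=> b12 e1n e1x e2x /triangular_base[c [[e1c e2c]|[e1c _]]].
  by rewrite (edge_eq_cancel e1x e1c) (edge_eq_cancel e2x e2c).
by rewrite (edge_eq_common b12 e1x e1c) in e1n.
Qed.

(* An edge of the star over [b1 b2 b3] missing its base vertex would join the
   other two base vertices. *)
Lemma extend_triangle b1 b2 b3 e1 e2 e3 :
  b1 != b2 -> b1 != b3 -> b2 != b3 ->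
  (forall e, e \in [:: e1; e2; e3] ->
     [/\ ~~ edge_eq e (b1, b2), ~~ edge_eq e (b1, b3) & ~~ edge_eq e (b2, b3)]) ->
  triangular (b1, b2) e1 e2 -> triangular (b1, b3) e1 e3 -> triangular (b2, b3) e2 e3 ->
  exists x, [/\ edge_eq e1 (b1, x), edge_eq e2 (b2, x) & edge_eq e3 (b3, x)].
Proof.
move=> b12 b13 b23 new t12 t13 t23.
have [n12 n13 n23] : [/\ ~~ edge_eq e1 (b1, b2), ~~ edge_eq e1 (b1, b3) & ~~ edge_eq e1 (b2, b3)].
  by apply: new; rewrite inE eqxx.
have [p12 p13 p23] : [/\ ~~ edge_eq e2 (b1, b2), ~~ edge_eq e2 (b1, b3) & ~~ edge_eq e2 (b2, b3)].
  by apply: new; rewrite !inE eqxx orbT.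
have [q12 q13 q23] : [/\ ~~ edge_eq e3 (b1, b2), ~~ edge_eq e3 (b1, b3) & ~~ edge_eq e3 (b2, b3)].
  by apply: new; rewrite !inE eqxx !orbT.
have flip a b e f : triangular (a, b) e f -> triangular (b, a) f e.
  by move=> /triangularAC; apply: triangular_eq; rewrite edge_eqC edge_eq_refl.
have [x1 e1x] := triangle_apex b23 n23 t12 t13.
have [x2 e2x] := triangle_apex b13 p13 (flip _ _ _ _ t12) t23.
have [x3 e3x] := triangle_apex b12 q12 (flip _ _ _ _ t13) (flip _ _ _ _ t23).
have x12 := same_apex b12 n12 e1x e2x t12.
have x13 := same_apex b13 n13 e1x e3x t13.
by exists x1; split; rewrite // ?x12 // -x12 x13.
Qed.

End Edges.

(** * Assignments of edges and the maps inducing them *)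

Section Assignments.
Variables (v : nat) (T : eqType).
Implicit Types psi : 'I_v -> 'I_v -> T * T.

(* Only the values of an assignment at [i < j] matter. *)
Definition injective_assignment psi :=
  [forall i : 'I_v, forall j : 'I_v, (i < j)%N ==> ((psi i j).1 != (psi i j).2)] &&
  [forall i : 'I_v, forall j : 'I_v, forall k : 'I_v, forall l : 'I_v,
     [&& (i < j)%N, (k < l)%N & edge_eq (psi i j) (psi k l)] ==>
     (i == k) && (j == l)].

Definition preserves_triangles psi :=
  [forall i : 'I_v, forall j : 'I_v, forall k : 'I_v,
     (i < j)%N && (j < k)%N ==> triangle (psi i j) (psi i k) (psi j k)].

Definition sym_assignment psi (i j : 'I_v) := if (i < j)%N then psi i j else psi j i.

Lemma sym_assignmentC psi i j : sym_assignment psi i j = sym_assignment psi j i.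
Proof.
by rewrite /sym_assignment; case: (ltngtP i j) => // /val_inj->.
Qed.

Lemma injective_assignmentP psi : reflect
  ((forall i j, i != j -> (sym_assignment psi i j).1 != (sym_assignment psi i j).2) /\
   (forall i j k l, i != j -> k != l ->
     edge_eq (sym_assignment psi i j) (sym_assignment psi k l) ->
     edge_eq (i, j) (k, l)))
  (injective_assignment psi).
Proof.
apply: (iffP andP) => -[H1 H2]; split.
- move=> i j; rewrite /sym_assignment -(inj_eq val_inj) neq_ltn.
  case: ltnP => /= [ij _|_ ji]; first exact: (implyP (forallP (forallP H1 i) j) ij).
  exact: (implyP (forallP (forallP H1 j) i) ji).
- have H (i j k l : 'I_v) : (i < j)%N -> (k < l)%N ->
      edge_eq (psi i j) (psi k l) -> (i, j) = (k, l).
    move=> ij kl e; have := implyP (forallP (forallP (forallP (forallP H2 i) j) k) l).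
    by rewrite ij kl e => /(_ isT) /andP[/eqP-> /eqP->].
  move=> i j k l; rewrite /sym_assignment -!(inj_eq val_inj) !neq_ltn.
  case: (ltnP i j) => /= [ij _|_ ij]; case: (ltnP k l) => /= [kl _|_ kl] /(H _ _ _ _ ij kl) [-> ->];
  by apply/edge_eqP; auto.
- apply/forallP => i; apply/forallP => j; apply/implyP => ij.
  have := H1 i j; rewrite /sym_assignment ij; apply.
  by rewrite -(inj_eq val_inj) neq_ltn ij.
- apply/forallP => i; apply/forallP => j; apply/forallP => k; apply/forallP => l.
  apply/implyP => /and3P[ij kl e]; have := H2 i j k l.
  rewrite /sym_assignment ij kl -!(inj_eq val_inj) !neq_ltn ij kl => /(_ isT isT e).
  case/edge_eqP => [[-> ->]|[ik jl]]; first by rewrite !eqxx.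
  by move: ij kl; rewrite ik jl => ij /(ltn_trans ij); rewrite ltnn.
Qed.

Lemma preserves_trianglesP psi : reflect
  (forall i j k, i != j -> i != k -> j != k ->
     triangular (sym_assignment psi i j) (sym_assignment psi i k) (sym_assignment psi j k))
  (preserves_triangles psi).
Proof.
apply: (iffP forallP) => H.
  have H' (i j k : 'I_v) : (i < j)%N -> (j < k)%N ->
      triangular (sym_assignment psi i j) (sym_assignment psi i k) (sym_assignment psi j k).
    move=> ij jk; rewrite /sym_assignment ij jk (ltn_trans ij jk); apply/triangleP.
    by have /forallP/(_ j)/forallP/(_ k) := H i; rewrite ij jk.
  move=> i j k; rewrite -!(inj_eq val_inj) !neq_ltn.
  have sC := sym_assignmentC psi.
  case/orP => ij /orP[] ik /orP[] jk.
  - exact: H'.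
  - by apply: triangularCA; rewrite (sC j k); exact: H'.
  - by move: (ltn_trans ij (ltn_trans jk ik)); rewrite ltnn.
  - by rewrite (sC i k) (sC j k); apply/triangularCA/triangularAC; exact: H'.
  - by rewrite (sC i j); apply/triangularAC; exact: H'.
  - by move: (ltn_trans ij (ltn_trans ik jk)); rewrite ltnn.
  - by rewrite (sC i j) (sC i k); apply/triangularAC/triangularCA; exact: H'.
  - rewrite (sC i j) (sC i k) (sC j k).
    by apply/triangularCA/triangularAC/triangularCA; exact: H'.
move=> i; apply/forallP => j; apply/forallP => k; apply/implyP => /andP[ij jk].
have ik := ltn_trans ij jk.
have := H i j k; rewrite /sym_assignment ij jk ik -!(inj_eq val_inj) !neq_ltn ij jk ik.
by move=> /(_ isT isT isT) /triangleP.
Qed.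

End Assignments.

(** The triangle on the vertices 0, 1, 2 fixes three image points; any other vertex goes to the
    common apex that [extend_triangle] provides, injectivity keeping its edges off the base
    triangle; the remaining edges are third sides of triangles through vertex 0. *)
Lemma induced_assignment3 v (T : choiceType) (psi : 'I_v.+3 -> 'I_v.+3 -> T * T) :
  injective_assignment psi -> preserves_triangles psi ->
  exists b : 'I_v.+3 -> T, injective b /\
    forall i j, i != j -> edge_eq (sym_assignment psi i j) (b i, b j).
Proof.
move=> /injective_assignmentP; set phi := sym_assignment psi => -[phi_neq phi_inj].
move=> /preserves_trianglesP; rewrite -/phi => tri.
have phiC i j : phi i j = phi j i by exact: sym_assignmentC.
have phi_ninj i j k l : i != j -> k != l -> ~~ edge_eq (i, j) (k, l) ->
    ~~ edge_eq (phi i j) (phi k l).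
  by move=> ij kl; apply: contraNN; exact: phi_inj.
pose o : 'I_v.+3 := ord0; pose p : 'I_v.+3 := inord 1; pose q : 'I_v.+3 := inord 2.
have op : o != p by rewrite -(inj_eq val_inj) /= inordK.
have oq : o != q by rewrite -(inj_eq val_inj) /= inordK.
have pq : p != q by rewrite -(inj_eq val_inj) /= !inordK.
have [bo [bp [bq [eop eoq epq]]]] := tri o p q op oq pq.
have edge_neq e a b : e.1 != e.2 -> edge_eq e (a, b) -> a != b :> T.
  by move=> eN /edge_eqP eE; case: eE eN => ->; rewrite //= eq_sym.
have bop := edge_neq _ _ _ (phi_neq _ _ op) eop.
have boq := edge_neq _ _ _ (phi_neq _ _ oq) eoq.
have bpq := edge_neq _ _ _ (phi_neq _ _ pq) epq.
have ext x : exists x', [/\ x != o -> edge_eq (phi o x) (bo, x'),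
    x != p -> edge_eq (phi p x) (bp, x') & x != q -> edge_eq (phi q x) (bq, x')].
  have [->|xo] := eqVneq x o.
    by exists bo; split => // _; rewrite phiC edge_eqC.
  have [->|xp] := eqVneq x p.
    by exists bp; split => // _; rewrite phiC edge_eqC.
  have [->|xq] := eqVneq x q; first by exists bq.
  have new y : y \in [:: phi o x; phi p x; phi q x] ->
     [/\ ~~ edge_eq y (bo, bp), ~~ edge_eq y (bo, bq) & ~~ edge_eq y (bp, bq)].
    have nx z k l e : z != x -> k != l -> x != k -> x != l -> edge_eq (phi k l) e ->
        ~~ edge_eq (phi z x) e.
      move=> zx kl xk xl kle; apply/negP => zxe.
      have : edge_eq (phi z x) (phi k l) by apply: edge_eq_trans zxe _; rewrite edge_eq_sym.
      move=> /(phi_inj _ _ _ _ zx kl) /edge_eqP[[_ xl']|[_ xk']]; first by rewrite xl' eqxx in xl.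
      by rewrite xk' eqxx in xk.
    rewrite !inE => /or3P[] /eqP->;
    (split; [apply: (nx _ o p)|apply: (nx _ o q)|apply: (nx _ p q)]) => //;
    by rewrite eq_sym.
  have [|||x' [e1 e2 e3]] := extend_triangle bop boq bpq new.
  - by apply: triangular_eq eop _; apply: tri; rewrite // eq_sym.
  - by apply: triangular_eq eoq _; apply: tri; rewrite // eq_sym.
  - by apply: triangular_eq epq _; apply: tri; rewrite // eq_sym.
  by exists x'.
have {ext} [b bE] := choice ext.
have boE : b o = bo.
  have [_ /(_ op) e _] := bE o; move: e; rewrite phiC => e.
  by apply: edge_eq_cancel (_ : edge_eq (phi o p) (bp, _)) _; rewrite // edge_eqC.
have star x : x != o -> edge_eq (phi o x) (b o, b x).
  by rewrite boE; case: (bE x).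
have bo_neq x : x != o -> b o != b x.
  by move=> xo; apply: edge_neq (star x xo); apply: phi_neq; rewrite eq_sym.
have b_inj : injective b.
  move=> x y bxy; apply/eqP; apply/negPn/negP => xy.
  have [xo|xo] := eqVneq x o.
    by have := bo_neq y; rewrite -xo eq_sym => /(_ xy); rewrite bxy eqxx.
  have [yo|yo] := eqVneq y o.
    by have := bo_neq x; rewrite -yo => /(_ xy); rewrite bxy eqxx.
  have := star x xo; rewrite bxy => ex.
  have : edge_eq (phi o x) (phi o y) by apply: edge_eq_trans ex _; rewrite edge_eq_sym star.
  move=> /phi_inj; rewrite eq_sym xo eq_sym yo => /(_ isT isT) /edge_eqP[[]|[_]] xy'.
    by rewrite xy' eqxx in xy.
  by rewrite xy' eqxx in xo.
exists b; split => // i j ij.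
have [io|io] := eqVneq i o; first by rewrite io; apply: star; rewrite -io eq_sym.
have [->|jo] := eqVneq j o.
  by rewrite phiC edge_eqC; exact: star.
apply: third_edge (star _ io) (star _ jo) _.
- exact: bo_neq.
- by rewrite (inj_eq b_inj).
- by apply: tri; rewrite // eq_sym.
Qed.

Lemma induced_assignment v (T : choiceType) (psi : 'I_v -> 'I_v -> T * T) :
  (2 < v)%N -> injective_assignment psi -> preserves_triangles psi ->
  exists b : 'I_v -> T, injective b /\
    forall i j, i != j -> edge_eq (sym_assignment psi i j) (b i, b j).
Proof. by case: v psi => [|[|[|v]]] psi // _; exact: induced_assignment3. Qed.

(** * Assignments that violate the relation *)

Lemma card_ltn_pairs v : #|[pred x : 'I_v * 'I_v | (x.1 < x.2)%N]| = 'C(v, 2).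
Proof.
rewrite -bin2_sum big_mkord -sum1_card.
rewrite -(pair_big_dep xpredT (fun i j : 'I_v => (i < j)%N) (fun _ _ => 1%N)) /=.
rewrite (exchange_big_dep xpredT) //=; apply: eq_bigr => j _.
rewrite sum1_card -[RHS]card_ord.
rewrite -(card_imset _ (f := widen_ord (ltnW (ltn_ord j)))); last first.
  by move=> a b /(congr1 val) /= /val_inj.
apply: eq_card => i; rewrite unfold_in; apply/idP/imsetP => [ij|[i' _ ->]].
  by exists (Ordinal ij) => //; apply: val_inj.
exact: (ltn_ord i').
Qed.

(** The squared distances that the assignment prescribes between the vertices; there need not be
    points that realize them. *)
Definition pullback (R : ringType) v (T : eqType) (d : T -> T -> R)
    (psi : 'I_v -> 'I_v -> T * T) (i j : 'I_v) : R :=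
  if i == j then 0 else d (sym_assignment psi i j).1 (sym_assignment psi i j).2.

(** Of size [m.+1], hence singular for the squared distances of points in R^m. *)
Definition gram_full (R : ringType) m (y : 'I_m.+2 -> 'I_m.+2 -> R) : 'M[R]_m.+1 :=
  gram y ord0 (lift ord0).

(** The last vertex [ord_max] is left out. For actual points, a nonzero determinant means that the
    first [m.+1] of them are affinely independent. *)
Definition gram_base (R : ringType) m (y : 'I_m.+2 -> 'I_m.+2 -> R) : 'M[R]_m :=
  gram y ord0 (fun i => lift ord0 (lift ord_max i)).

Section Witness.
Variables (R : realType) (m n : nat).
Implicit Types p w : 'M[R]_(m, n).

Lemma sqdistC p i j : sqdist p i j = sqdist p j i.
Proof. by apply: eq_bigr => k _; rewrite -sqrrN opprB. Qed.

Lemma sqdist_edge_eq p e f :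
  edge_eq e f -> sqdist p e.1 e.2 = sqdist p f.1 f.2.
Proof. by case: e f => [a b] [c d] /edge_eqP[[-> ->]|[-> ->]] //=; exact: sqdistC. Qed.

Lemma pullbackC p v (psi : 'I_v -> 'I_v -> 'I_n * 'I_n) i j :
  pullback (sqdist p) psi i j = pullback (sqdist p) psi j i.
Proof. by rewrite /pullback eq_sym sym_assignmentC. Qed.

Lemma pullback_induced p v (psi : 'I_v -> 'I_v -> 'I_n * 'I_n) b i j :
  (forall i j, i != j -> edge_eq (sym_assignment psi i j) (b i, b j)) ->
  pullback (sqdist p) psi i j = sqdist p (b i) (b j).
Proof.
move=> bE; rewrite /pullback; case: eqVneq => [->|ij].
  by rewrite /sqdist big1 // => k _; rewrite subrr expr0n.
exact: sqdist_edge_eq (bE _ _ ij).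
Qed.

End Witness.

(** The assignment is induced by an injective [b]. With the images of the vertices 1 to [m] at the
    standard basis vectors and all other points at 0, the Gram matrix is twice the identity. *)
Lemma witness_triangles (R : realType) m n (psi : 'I_m.+2 -> 'I_m.+2 -> 'I_n * 'I_n) :
  (0 < m)%N -> injective_assignment psi -> preserves_triangles psi ->
  exists w : 'M[R]_(m, n), \det (gram_base (pullback (sqdist w) psi)) != 0.
Proof.
case: m psi => // m' psi _ inj tri.
have [b [b_inj bE]] := induced_assignment (isT : 2 < m'.+3)%N inj tri.
pose f (r : 'I_m'.+1) : 'I_m'.+3 := lift ord0 (lift ord_max r).
have f_inj : injective f by apply: inj_comp; exact: lift_inj.
pose w : 'M[R]_(m'.+1, n) := \matrix_(r, u) (u == b (f r))%:R.
exists w.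
suff -> : gram_base (pullback (sqdist w) psi) = 2%:M.
  by rewrite det_scalar expf_neq0 // pnatr_eq0.
have dE i j : pullback (sqdist w) psi i j =
    \sum_k ((i == f k)%:R - (j == f k)%:R) ^+ 2.
  rewrite (pullback_induced _ _ _ bE); apply: eq_bigr => k _.
  by rewrite !mxE !(inj_eq b_inj).
have f0 r : (ord0 == f r) = false by [].
have d0 r : pullback (sqdist w) psi ord0 (f r) = 1.
  rewrite dE // (bigD1 r) //= eqxx /= sub0r sqrrN expr1n big1 ?addr0 // => k kr.
  by rewrite (inj_eq f_inj) eq_sym (negPf kr) subr0 expr0n.
apply/matrixP => r s; rewrite !mxE -/(f r) -/(f s) !d0.
have [->|rs] := eqVneq r s; first by rewrite /pullback eqxx subr0.
rewrite dE (bigD1 r) //= (bigD1 s) /=; last by rewrite eq_sym.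
rewrite !(inj_eq f_inj).
rewrite !eqxx (negPf rs) (eq_sym s r) (negPf rs) big1 => [|k /andP[kr ks]].
  by rewrite subr0 sub0r sqrrN expr1n addr0 subrr.
by rewrite !(inj_eq f_inj) !(eq_sym _ k) (negPf kr) (negPf ks) subr0 expr0n.
Qed.


Definition contract (T : eqType) (a b x : T) := if x == b then a else x.

Lemma contract_eq (T : eqType) (a b x y : T) :
  contract a b x = contract a b y -> x = y \/ edge_eq (x, y) (a, b).
Proof.
rewrite /contract; case: (eqVneq x b) => [->|_]; case: (eqVneq y b) => [->|_]; auto.
- by move=> ->; right; apply/edge_eqP; right.
- by move=> ->; right; apply/edge_eqP; left.
Qed.

(** Ends that are identified are equal or are [a] and [b]. If both pairs of ends differ, [e] itself
    joins [a] and [b]; if exactly one does, the three edges form a triangle. *)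
Lemma contracted_parallel (T : eqType) (a b : T) (e f : T * T) :
  e.1 != e.2 -> ~~ edge_eq e (a, b) -> ~~ edge_eq e f ->
  edge_eq (contract a b e.1, contract a b e.2) (contract a b f.1, contract a b f.2) ->
  triangular (a, b) e f.
Proof.
have main (g : T * T) : e.1 != e.2 -> ~~ edge_eq e (a, b) -> ~~ edge_eq e g ->
    contract a b e.1 = contract a b g.1 -> contract a b e.2 = contract a b g.2 ->
    triangular (a, b) e g.
  case: e g => [e1 e2] [g1 g2] /= e12 eab eg.
  case/contract_eq => [eg1|/edge_eqP eg1]; case/contract_eq => [eg2|/edge_eqP eg2].
  - by move: eg; rewrite eg1 eg2 edge_eq_refl.
  - rewrite eg1; exists e2, g2, g1; split; first by apply/edge_eqP; case: eg2 => -[-> ->]; auto.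
      by apply/edge_eqP; auto.
    by apply/edge_eqP; auto.
  - rewrite eg2; exists e1, g1, g2; split; try by apply/edge_eqP; auto.
    by apply/edge_eqP; case: eg1 => -[-> ->]; auto.
  - case/edge_eqP: eab.
    by case: eg1 e12 => -[-> _]; case: eg2 => -[-> _]; rewrite ?eqxx; auto.
move=> e12 eab ef /edge_eqP[[]|[]]; first exact: main.
move=> ef1 ef2; have : triangular (a, b) e (f.2, f.1).
  by apply: main => //; rewrite edge_eqC -surjective_pairing.
move=> [x [y [z [? ? fyz]]]]; exists x, y, z; split=> //.
by move: fyz; case: (f) => f1 f2 /= /edge_eqP[[-> ->]|[-> ->]]; apply/edge_eqP; auto.
Qed.

Section NonTriangular.
Variables (R : realType) (m n : nat).

(* Contracting the edge [psi i j] leaves fewer than ['C(m.+2, 2)] edges, so the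
   points can be put on the vertices of a regular simplex with that edge
   collapsed and all the others of the same length. If [psi i k] and [psi j k]
   do not form a triangle with it, then they can be given different lengths by
   moving a single point. *)
Lemma witness_no_triangle (psi : 'I_m.+2 -> 'I_m.+2 -> 'I_n * 'I_n) :
  (0 < m)%N -> injective_assignment psi -> ~~ preserves_triangles psi ->
  exists w : 'M[R]_(m, n), \det (gram_full (pullback (sqdist w) psi)) != 0.
Proof.
move=> m0 /injective_assignmentP; set phi := sym_assignment psi => -[phi_neq phi_inj].
move=> /forallPn[i /forallPn[j /forallPn[k]]]; rewrite negb_imply => /andP[/andP[ij jk] ntri].
have ik := ltn_trans ij jk.
have phi_lt (u v : 'I_m.+2) : (u < v)%N -> psi u v = phi u v by rewrite /phi /sym_assignment => ->.
rewrite !phi_lt // {phi_lt} in ntri.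
have nij : i != j by rewrite -(inj_eq val_inj) neq_ltn ij.
have nik : i != k by rewrite -(inj_eq val_inj) neq_ltn ik.
have njk : j != k by rewrite -(inj_eq val_inj) neq_ltn jk.
have phiC x y : phi x y = phi y x by exact: sym_assignmentC.
case eij: (phi i j) (phi_neq _ _ nij) => [a b] /= ab.
rewrite eij in ntri.
have nab x y : x != y -> ~~ edge_eq (x, y) (i, j) -> ~~ edge_eq (phi x y) (a, b).
  by move=> xy; rewrite -eij; apply: contraNN; exact: phi_inj.
pose K (e : 'I_n * 'I_n) := (contract a b e.1, contract a b e.2).
have K_neq e : e.1 != e.2 -> ~~ edge_eq e (a, b) -> (K e).1 != (K e).2.
  move=> e12; apply: contraNN => /eqP /contract_eq[e12'|].
    by rewrite e12' eqxx in e12.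
  by rewrite -surjective_pairing.
(* A colouring of the contracted graph, in which every edge but [phi i j] keeps two different
   ends. *)
have [c c_neq] : exists c : 'I_n -> 'I_m.+1, forall x y, x != y ->
    ~~ edge_eq (x, y) (i, j) -> c (K (phi x y)).1 != c (K (phi x y)).2.
  pose P := [pred x : 'I_m.+2 * 'I_m.+2 | (x != (i, j)) && (x.1 < x.2)%N].
  have PE x : x \in P -> (x.1 != x.2) && ~~ edge_eq x (i, j).
    case: x => x y; rewrite inE => /andP[nxy /= xy].
    rewrite -(inj_eq val_inj) neq_ltn xy /edge_eq negb_or nxy /=.
    by apply: contraL xy => /eqP[-> ->]; rewrite -leqNgt ltnW.
  have [||c /allP cP] := @few_edges_colorable m n [seq K (phi x.1 x.2) | x <- enum P].
  - rewrite all_map; apply/allP => x; rewrite mem_enum => /PE/andP[x12 xij] /=.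
    by apply: K_neq; [exact: phi_neq | apply: nab; rewrite // -surjective_pairing].
  - rewrite size_map -cardE -card_ltn_pairs [ltnRHS](cardD1 (i, j)) [(i, j) \in _]ij add1n ltnS.
    by apply/subset_leq_card/fintype.subsetP => x; rewrite !inE.
  exists c; have H (x y : 'I_m.+2) : (x < y)%N -> ~~ edge_eq (x, y) (i, j) -> 
      c (K (phi x y)).1 != c (K (phi x y)).2.
    move=> xy; rewrite /edge_eq negb_or => /andP[nxy _].
    by apply: cP; apply/mapP; exists (x, y); rewrite // mem_enum inE nxy.
  move=> x y; rewrite -(inj_eq val_inj) neq_ltn => /orP[xy|yx nxy]; first exact: H.
  rewrite phiC; apply: H => //; apply: contraNN nxy.
  by move=> /edge_eqP[[-> ->]|[-> ->]]; apply/edge_eqP; auto.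
have nikij : ~~ edge_eq (i, k) (i, j).
  apply/edge_eqP => -[[kj]|[ij' _]]; first by rewrite kj eqxx in njk.
  by rewrite ij' eqxx in nij.
have njkij : ~~ edge_eq (j, k) (i, j).
  apply/edge_eqP => -[[ji]|[ki]]; first by rewrite ji eqxx in nij.
  by rewrite ki eqxx in nik.
set f := phi i k in ntri; set g := phi j k in ntri.
have nfg : ~~ edge_eq (K f) (K g).
  apply: contraNN ntri => Kfg; apply/triangleP.
  apply: contracted_parallel Kfg; [exact: phi_neq | exact: nab |].
  apply/negP => /(phi_inj _ _ _ _ nik njk)/edge_eqP[[ij']|[ik' _]].
    by rewrite ij' eqxx in nij.
  by rewrite ik' eqxx in nik.
have f_neq : (K f).1 != (K f).2 by apply: K_neq; [exact: phi_neq | exact: nab].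
have cf_neq : c (K f).1 != c (K f).2 by exact: c_neq.
(* As [K f] and [K g] are different edges, [K f] has an end [x] outside [K g]; moving [x] changes
   the length of [f] and not that of [g]. *)
have [x [z [fxz gx czx]]] : exists x z, [/\ edge_eq (K f) (x, z),
    (x != (K g).1) && (x != (K g).2) & c x != c z].
  move: (K f) (K g) f_neq cf_neq nfg => [f1 f2] [g1 g2] /= f12 cf12 nfg.
  case: (boolP ((f1 != g1) && (f1 != g2))) => [h|]; first by exists f1, f2; rewrite edge_eq_refl.
  rewrite negb_and !negbK => f1g; exists f2, f1; split; last by rewrite eq_sym.
    by apply/edge_eqP; auto.
  apply: contraNT nfg; rewrite negb_and !negbK => f2g; apply/edge_eqP; move: f12.
  by case/orP: f1g => /eqP->; case/orP: f2g => /eqP->; rewrite ?eqxx; auto.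
have [s sP] := regular_simplex R m0.
(* There are [m.+2] vertices, so the bound of [collapsed_gram] reads [1 < 2]. Moving [x] by the
   factor [t] changes a squared length 2 by at most [4 * t + 2 * t ^ 2 <= 6 * t]. *)
pose eps : R := m.+2%:R^-1; pose t := eps / 6.
have eps0 : 0 < eps by rewrite invr_gt0.
have eps1 : eps <= 1 by rewrite invf_le1 // ler1n.
pose D r := s (c x) r - s (c z) r.
(* Each point sits at the simplex vertex of its colour, except that the class [x] is pushed away
   from the vertex of [z]. *)
pose w : 'M[R]_(m, n) := \matrix_(r, u)
  (s (c (contract a b u)) r + (contract a b u == x)%:R * t * D r).
exists w.
have DD : \sum_r D r ^+ 2 = 2 by exact: sP.
have dE e : sqdist w e.1 e.2 = \sum_r (s (c (K e).1) r - s (c (K e).2) r +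
    (((K e).1 == x)%:R - ((K e).2 == x)%:R) * t * D r) ^+ 2.
  by apply: eq_bigr => r _; rewrite !mxE /K /=; congr (_ ^+ 2); ring.
pose y := pullback (sqdist w) psi.
have yE u v : u != v -> y u v = sqdist w (phi u v).1 (phi u v).2.
  by rewrite /y /pullback => /negPf->.
have dk e u v : edge_eq (K e) (u, v) -> sqdist w e.1 e.2 =
    \sum_r (s (c u) r - s (c v) r + ((u == x)%:R - (v == x)%:R) * t * D r) ^+ 2.
  rewrite dE; case: (K e) => e1 e2 /edge_eqP[[-> ->]|[-> ->]] //=.
  by apply: eq_bigr => r _; rewrite -sqrrN; congr (_ ^+ 2); ring.
have xz : (z == x) = false by apply: contraNF czx => /eqP->.
apply: (@collapsed_gram _ _ y i j k eps); rewrite -?/y //.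
- by move=> u v; exact: pullbackC.
- by move=> u; rewrite /y /pullback eqxx.
- exact: ltW.
- rewrite yE // dE eij /K /= /contract eqxx (negPf ab) big1 // => r _.
  by rewrite !subrr !mul0r addr0 expr0n.
- move=> u v uv nuv nvu.
  have nuvij : ~~ edge_eq (u, v) (i, j).
    by rewrite /edge_eq negb_or /= !xpair_eqE nuv nvu.
  rewrite yE // dE; set e := K _; set o : R := (e.1 == x)%:R - (e.2 == x)%:R.
  pose A r := s (c e.1) r - s (c e.2) r.
  have AA : \sum_r A r ^+ 2 = 2 by apply: sP; exact: c_neq.
  have expand q : \sum_r (A r + q * D r) ^+ 2 =
      2 + 2 * q * (\sum_r A r * D r) + q ^+ 2 * 2.
    transitivity (\sum_r A r ^+ 2 + 2 * q * (\sum_r A r * D r) + q ^+ 2 * (\sum_r D r ^+ 2)).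
      by rewrite !mulr_sumr -!big_split /=; apply: eq_bigr => r _; ring.
    by rewrite AA DD.
  rewrite expand; set AD := \sum_r A r * D r.
  (* Cauchy-Schwarz, read off from the squared norms of [A + D] and [A - D]. *)
  have ADb : - 2 <= AD <= 2.
    have h (q : R) : 0 <= 2 + 2 * q * AD + q ^+ 2 * 2.
      by rewrite -expand; apply: sumr_ge0 => r _; exact: sqr_ge0.
    by have := h 1; have := h (-1); lra.
  have [t0 t1] : 0 <= t /\ t <= 1 by rewrite /t; lra.
  have -> : eps = 6 * t by rewrite /t; field.
  have : [\/ o = 0, o = 1 | o = -1].
    rewrite /o; case: eqP => _; case: eqP => _;
      [apply: Or31|apply: Or32|apply: Or33|apply: Or31]; rewrite /=; ring.
  by rewrite ler_norml; case=> ->; nra.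
- by rewrite mulfV ?pnatr_eq0 //; lra.
have -> : y k i = sqdist w f.1 f.2 by rewrite yE 1?eq_sym // phiC.
have -> : y k j = sqdist w g.1 g.2 by rewrite yE 1?eq_sym // phiC.
rewrite (dk f x z fxz) dE eqxx xz /=.
case/andP: gx; rewrite ![x == _]eq_sym => /negPf-> /negPf->.
have -> : \sum_r (s (c x) r - s (c z) r + (1 - 0) * t * D r) ^+ 2 = (1 + t) ^+ 2 * 2.
  by rewrite -DD mulr_sumr; apply: eq_bigr => r _; rewrite /D; ring.
rewrite (_ : \sum_r _ = 2); last first.
  rewrite -[RHS](sP (c (K g).1) (c (K g).2)); last by exact: c_neq.
  by apply: eq_bigr => r _; congr (_ ^+ 2); ring.
by rewrite gt_eqF // /t; nra.
Qed.

End NonTriangular.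

(** * Congruence *)

Lemma perm_eq_image_bijection (T : finType) (S : eqType) (P : {pred T}) (F G : T -> S) :
  perm_eq [seq F x | x in P] [seq G x | x in P] ->
  exists f : T -> T, [/\ {in P, forall x, f x \in P}, {in P &, injective f} &
    {in P, forall x, G x = F (f x)}].
Proof.
case: (pickP P) => [t0 _|P0 _]; last first.
  by exists id; split => // x; rewrite unfold_in P0.
rewrite perm_sym => /(perm_iotaP (F t0))[Is]; rewrite size_map => Isp GE.
have size_Is : size Is = size (enum P) by rewrite (perm_size Isp) size_iota.
have uIs : uniq Is by rewrite (perm_uniq Isp) iota_uniq.
have Is_lt k : (k < size (enum P))%N -> (nth 0 Is k < size (enum P))%N.
  move=> kP; have : nth 0 Is k \in Is by rewrite mem_nth ?size_Is.
  by rewrite (perm_mem Isp) mem_iota.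
have idx x : x \in P -> (index x (enum P) < size (enum P))%N.
  by rewrite index_mem mem_enum.
exists (fun x => nth t0 (enum P) (nth 0 Is (index x (enum P)))); split.
- by move=> x Px; rewrite -mem_enum mem_nth // Is_lt // idx.
- move=> x y Px Py /eqP; rewrite nth_uniq ?enum_uniq ?Is_lt ?idx //.
  rewrite nth_uniq ?size_Is ?idx // => /eqP e.
  by rewrite -(nth_index t0 (_ : x \in enum P)) ?mem_enum // e nth_index ?mem_enum.
- move=> x Px; have := congr1 (fun l => nth (F t0) l (index x (enum P))) GE.
  rewrite (nth_map t0) ?idx // nth_index ?mem_enum // => ->.
  by rewrite (nth_map 0%N) ?size_Is ?idx // (nth_map t0) // Is_lt // idx.
Qed.

Section Euclidean.
Variables (R : realType) (m n : nat).
Implicit Types p q : 'M[R]_(m, n).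

Lemma sqdist_ge0 p i j : 0 <= sqdist p i j.
Proof. by apply: sumr_ge0 => k _; exact: sqr_ge0. Qed.

Lemma sqdist_refl p i : sqdist p i i = 0.
Proof. by rewrite /sqdist big1 // => k _; rewrite subrr expr0n. Qed.

Lemma dmax_gt0 p : not_all_equal p -> 0 < dmax p.
Proof.
move=> [i [j pij]].
have [k pk] : exists k, p k i != p k j.
  apply: contrapT => /forallNP pk; apply: pij; apply/colP => k; rewrite !mxE.
  by apply/eqP/negPn/negP/pk.
have dij : 0 < sqdist p i j.
  rewrite lt_neqAle sqdist_ge0 andbT eq_sym; apply/eqP => /psumr_eq0P d0.
  have /eqP := d0 (fun k _ => sqr_ge0 _) k isT.
  by rewrite sqrf_eq0 subr_eq0 (negPf pk).
have ij : i != j by apply: contra_neq pk => ->.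
move: ij; rewrite -(inj_eq val_inj) neq_ltn => /orP[ij|ji]; apply: lt_le_trans dij _.
  by rewrite /dmax (bigmaxD1 (i, j)) ?le_max ?lexx.
rewrite sqdistC.
by rewrite /dmax (bigmaxD1 (j, i)) ?le_max ?lexx.
Qed.

Lemma polarization p o i j :
  sqdist p o i + sqdist p o j - sqdist p i j =
  2 * \sum_k (p k i - p k o) * (p k j - p k o).
Proof.
by rewrite mulr_sumr /sqdist -big_split /= -sumrB; apply: eq_bigr => k _; ring.
Qed.

Definition frame p (I : Type) k (b : I -> 'I_n) (o : I) (f : 'I_k -> I) : 'M[R]_(m, k) :=
  \matrix_(i, r) (p i (b (f r)) - p i (b o)).

Lemma gram_sqdist p (I : Type) k (b : I -> 'I_n) (o : I) (f : 'I_k -> I) c :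
  gram (fun i j => c * sqdist p (b i) (b j)) o f =
  (2 * c) *: ((frame p b o f)^T *m frame p b o f).
Proof.
apply/matrixP => i j; rewrite !mxE -mulrDr -mulrBr polarization mulrA (mulrC c).
by congr (_ * _); apply: eq_bigr => l _; rewrite !mxE.
Qed.

(** A Gram matrix of [m.+1] vectors in R^m has rank at most [m]. *)
Lemma gram_sqdist_singular p (b : 'I_m.+2 -> 'I_n) c :
  \det (gram_full (fun i j => c * sqdist p (b i) (b j))) = 0.
Proof.
rewrite /gram_full gram_sqdist detZ; set F := frame _ _ _ _.
suff -> : \det (F^T *m F) = 0 by rewrite mulr0.
apply/eqP/negPn/negP => Fu.
have : F^T *m F \in unitmx by rewrite unitmxE unitfE.
move=> /mxrank_unit rF; have := mxrankM_maxl F^T F.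
by rewrite rF leqNgt ltnS rank_leq_col.
Qed.

End Euclidean.

Lemma eq_gram (R : ringType) (I : Type) k (y z : I -> I -> R) o (f : 'I_k -> I) :
  (forall i j, y i j = z i j) -> gram y o f = gram z o f.
Proof. by move=> yz; apply/matrixP => i j; rewrite !mxE !yz. Qed.

(* Distances to an affine basis determine the scalar products with it, hence
   the point. *)
Lemma congruent_extension (R : realType) m n (p q : 'M[R]_(m, n)) (I : Type)
    (b s : I -> 'I_n) (o : I) (f : 'I_m -> I) (g : 'I_n -> 'I_n) lambda :
  0 < lambda -> \det (gram (fun i j => sqdist p (b i) (b j)) o f) != 0 ->
  (forall i, g (s i) = b i) ->
  (forall x i, sqdist q x (s i) = lambda * sqdist p (g x) (b i)) ->
  exists (M : 'M[R]_m) (T : 'cV[R]_m) (mu : R), [/\ M^T *m M = 1%:M, mu != 0 &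
    forall x, mu *: (M *m col (g x) p + T) = col x q].
Proof.
move=> l0 det0 gs dq; pose mu := Num.sqrt lambda.
have mu2 : mu ^+ 2 = lambda by rewrite sqr_sqrtr // ltW.
have mu0 : mu != 0 by rewrite gt_eqF // sqrtr_gt0.
(* [B] holds the basis vectors of [p], and [C] those of [q] divided by the scale [mu]. They have
   equal scalar products, so the matrix [M] taking [B] to [C] is orthogonal. *)
pose B := frame p b o f; pose C := mu^-1 *: frame q s o f.
pose u x := col (g x) p - col (b o) p; pose w x := mu^-1 *: (col x q - col (s o) q).
have CwBu x : C^T *m w x = B^T *m u x.
  apply/matrixP => r c; rewrite !mxE.
  have := polarization p (b o) (b (f r)) (g x).
  have := polarization q (s o) (s (f r)) x.
  rewrite !(sqdistC q _ x) !dq gs !(sqdistC p (g x)).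
  rewrite -mulrDr -mulrBr => + pE; rewrite pE mulrCA => /mulfI.
  rewrite pnatr_eq0 => /(_ isT) qE.
  rewrite (eq_bigr (fun k => mu^-1 ^+ 2 *
    ((q k (s (f r)) - q k (s o)) * (q k x - q k (s o))))); last first.
    by move=> k _; rewrite !mxE; ring.
  rewrite -mulr_sumr -qE -mu2 exprVn mulKf ?expf_neq0 //.
  by apply: eq_bigr => k _; rewrite !mxE.
have CCBB : C^T *m C = B^T *m B.
  apply/row_matrixP => r; apply/rowP => c.
  have /matrixP/(_ r 0) := CwBu (s (f c)); rewrite !mxE => e.
  transitivity (\sum_j C^T r j * w (s (f c)) j 0).
    by apply: eq_bigr => k _; rewrite !mxE.
  by rewrite e; apply: eq_bigr => k _; rewrite !mxE gs.
have B_unit : B \in unitmx.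
  rewrite unitmxE unitfE; apply: contra_neq det0 => B0.
  rewrite (eq_gram (z := fun i j => 1 * sqdist p (b i) (b j))); last by move=> *; rewrite mul1r.
  by rewrite gram_sqdist detZ det_mulmx -/B B0 mulr0 mulr0.
have C_unit : C^T \in unitmx.
  have : C^T *m C \in unitmx by rewrite CCBB unitmx_mul unitmx_tr B_unit.
  by rewrite unitmx_mul => /andP[].
pose M := C *m invmx B.
have Mu x : M *m u x = w x.
  apply: (can_inj (mulKmx C_unit)); rewrite CwBu /M !mulmxA CCBB.
  by rewrite mulmxK.
exists M, (mu^-1 *: col (s o) q - M *m col (b o) p), mu; split => //.
  rewrite trmx_mul mulmxA -(mulmxA _ C^T) CCBB mulmxA -(mulmxA _ _ (invmx B)) mulmxV // mulmx1.
  by rewrite -trmx_mul mulmxV // trmx1.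
move=> x; have := Mu x; rewrite /u /w mulmxBr scalerBr => /eqP.
rewrite subr_eq => /eqP->; set N := M *m _; set S := mu^-1 *: col (s o) q.
have -> : mu^-1 *: col x q - S + N + (S - N) = mu^-1 *: col x q.
  by rewrite addrACA subrr addr0 subrK.
by rewrite scalerA divff // scale1r.
Qed.

(** * Packing *)

(** [crowded_ball] uses [(m.*2).+1 ^ m] cells; one point more than [m.+1] per cell forces [m.+2]
    points into one of them. *)
Definition packing_bound m := (m.+1 * (m.*2).+1 ^ m).+1.

Definition edge_rank (R : realType) m n (p : 'M[R]_(m, n)) (e : 'I_n * 'I_n) :=
  #|[pred f : 'I_n * 'I_n | (f.1 < f.2)%N &&
       (sqdist p f.1 f.2 < sqdist p e.1 e.2)]|.

Lemma edge_rank_le (R : realType) m n (p : 'M[R]_(m, n)) e f :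
  sqdist p e.1 e.2 <= sqdist p f.1 f.2 -> (edge_rank p e <= edge_rank p f)%N.
Proof.
move=> ef; apply/subset_leq_card/fintype.subsetP => g; rewrite !inE.
by case/andP=> -> /lt_le_trans->.
Qed.

Lemma pigeonhole (J C : finType) (A : {set J}) (h : J -> C) k :
  (k * #|C| < #|A|)%N -> exists c, (k < #|[set x in A | h x == c]|)%N.
Proof.
move=> kA; apply: contrapT => /forallNP hk.
suff: (#|A| <= k * #|C|)%N by rewrite leqNgt kA.
rewrite -sum1_card (partition_big h xpredT) //=.
apply: (@leq_trans (\sum_(c : C) k)); last by rewrite sum_nat_const mulnC.
apply: leq_sum => c _; rewrite leqNgt; apply/negP => kc; apply: (hk c).
by rewrite -sum1_card; under eq_bigl do rewrite inE.
Qed.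

(* Cut the cube of side [2 * rho] around the common point into cells of side
   [rho / m]: points of the same cell are at distance at most [rho]. *)
Lemma crowded_ball (R : realType) m n (q : 'M[R]_(m, n)) o (J : {set 'I_n}) (r : R) :
  (0 < m)%N -> (packing_bound m <= #|J|)%N ->
  {in J, forall j, sqdist q o j <= r} ->
  exists A : {set 'I_n}, [/\ A \subset J, (m.+1 < #|A|)%N &
    {in A &, forall i j, sqdist q i j <= r}].
Proof.
move=> m0 Jcard Jr.
have r0 : 0 <= r.
  have /card_gt0P[j jJ] : (0 < #|J|)%N by apply: leq_trans Jcard.
  by apply: le_trans (Jr _ jJ); exact: sqdist_ge0.
pose rho := Num.sqrt r.
have rho2 : rho ^+ 2 = r by rewrite sqr_sqrtr.
have rho0 : 0 <= rho by exact: sqrtr_ge0.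
have mR : 0 < m%:R :> R by rewrite ltr0n.
have coord j k : j \in J -> - rho <= q k j - q k o <= rho.
  move=> jJ; rewrite -ler_norml -(ler_pXn2r (n := 2)) ?nnegrE // rho2 real_normK ?num_real //.
  apply: le_trans (Jr _ jJ); rewrite /sqdist (bigD1 k) //= -sqrrN opprB lerDl.
  by apply: sumr_ge0 => *; exact: sqr_ge0.
(* For radius 0 the cells would have side 0, but then all points of [J] coincide. *)
have [rho00|rho_neq0] := eqVneq rho 0.
  exists J; split => //.
    apply: leq_trans Jcard; rewrite /packing_bound ltnS leq_pmulr // expn_gt0 //.
  move=> i j iJ jJ; rewrite /sqdist big1 // => k _.
  by have := coord i k iJ; have := coord j k jJ; rewrite rho00 => ? ?; 
    rewrite (_ : q k i - q k j = 0) ?expr0n //; lra.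
have rho_gt0 : 0 < rho by rewrite lt_neqAle eq_sym rho_neq0.
pose side := rho / m%:R.
have side0 : 0 < side by rewrite divr_gt0.
(* The cube is closed: the coordinate [rho] gets the index [2 * m], which accounts for the extra
   cell in each direction. *)
pose h (j : 'I_n) : {ffun 'I_m -> 'I_(m.*2).+1} :=
  [ffun k => inord (Num.trunc ((q k j - q k o + rho) / side))].
have h_lt j k : j \in J -> (Num.trunc ((q k j - q k o + rho) / side) < (m.*2).+1)%N.
  move=> jJ; have /andP[lo hi] := coord j k jJ.
  rewrite ltnS truncn_le_nat ltr_pdivrMr //.
  have -> : (m.*2).+1%:R = 2 * m%:R + 1 :> R by rewrite -natr1 -mul2n natrM.
  have sm : side * m%:R = rho by rewrite divfK ?gt_eqF.
  rewrite mulrDl mul1r -mulrA (mulrC m%:R) sm.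
  by lra.
have [c Ac] : exists c, (m.+1 < #|[set x in J | h x == c]|)%N.
  by apply: pigeonhole; rewrite card_ffun !card_ord.
exists [set x in J | h x == c]; split => //.
  by apply/fintype.subsetP => x; rewrite inE => /andP[].
move=> i j; rewrite !inE => /andP[iJ /eqP hi] /andP[jJ /eqP hj].
have hij k : `|q k i - q k j| <= side.
  have : h i k = h j k by rewrite hi hj.
  rewrite !ffunE => /(congr1 val) /=; rewrite !inordK ?h_lt // => tE.
  have ge0 x : x \in J -> 0 <= (q k x - q k o + rho) / side.
    by move=> xJ; apply: divr_ge0; [have := coord x k xJ; lra | exact: ltW].
  pose t x : R := (Num.trunc ((q k x - q k o + rho) / side))%:R.
  have cell x (xJ : x \in J) : t x * side <= q k x - q k o + rho < t x * side + side.
    have := truncn_itv (ge0 _ xJ); rewrite -natr1 -/(t x).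
    by rewrite ler_pdivlMr // ltr_pdivrMr // mulrDl mul1r.
  have := cell _ iJ; have := cell _ jJ; rewrite (_ : t i = t j) ?/t ?tE // => /andP[? ?] /andP[? ?].
  by rewrite ler_norml; apply/andP; split; lra.
(* The bound is [m * side ^ 2 = r / m]. *)
apply: (@le_trans _ _ (\sum_(k < m) side ^+ 2)).
  apply: ler_sum => k _; rewrite -real_normK ?num_real //.
  by rewrite ler_pXn2r ?nnegrE ?hij // ltW.
rewrite sumr_const card_ord -mulr_natl /side expr_div_n rho2.
rewrite mulrCA ler_piMr // expr2 invfM mulrA divff ?gt_eqF // mul1r invf_le1 // ler1n //.
Qed.

(* Among the [packing_bound m * n] shortest edges some point has
   [packing_bound m] neighbours, and a crowded ball contains a clique of
   edges that are at most as long as its radius. *)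
Lemma short_clique (R : realType) m n (q : 'M[R]_(m, n)) :
  (0 < m)%N -> (m.+2 <= n)%N ->
  exists s : 'I_m.+2 -> 'I_n, injective s /\
    forall i j, i != j -> (edge_rank q (s i, s j) < packing_bound m * n)%N.
Proof.
move=> m0 mn; set L := (_ * n)%N.
pose P := [set e : 'I_n * 'I_n | (e.1 < e.2)%N].
pose S := [set e in P | (edge_rank q e < L)%N].
have rankC i j : edge_rank q (i, j) = edge_rank q (j, i).
  by rewrite /edge_rank /= sqdistC.
(* If fewer than [L] edges have rank below [L], these are all the edges, since only edges of [S] are
   shorter than a shortest missing one. Then any [m.+2] points will do. *)
have [LS|SL] := leqP L #|S|; last first.
  have SP : S = P.
    apply/eqP; apply: contraT; rewrite finset.eqEsubset => SnP.
    have [e eP] : exists e, e \in P :\: S.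
      apply/set0Pn; rewrite finset.setD_eq0; apply: contraNN SnP => ->.
      by rewrite andbT; apply/fintype.subsetP => x; rewrite inE => /andP[].
    have [f + fmin] : exists2 f, f \in P :\: S &
        forall g, g \in P :\: S -> sqdist q f.1 f.2 <= sqdist q g.1 g.2.
      by case: (arg_minP (P := mem (P :\: S)) (fun e => sqdist q e.1 e.2) eP) => f; exists f.
    rewrite !inE => /andP[+ fP]; rewrite fP /= -leqNgt => Lf.
    suff: (edge_rank q f <= #|S|)%N by rewrite leqNgt (leq_trans SL).
    apply/subset_leq_card/fintype.subsetP => g; rewrite inE => /andP[gP gf].
    apply: contraTT gf => gS; rewrite -leNgt; apply: fmin.
    by rewrite !inE gP /= andbT; move: gS; rewrite !inE gP.
  exists (widen_ord mn); split=> [i j /(congr1 val)/= ij|i j]; first exact: val_inj.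
  have H (a b : 'I_n) : (a < b)%N -> (edge_rank q (a, b) < L)%N.
    move=> ab; have : (a, b) \in S by rewrite SP inE.
    by rewrite inE => /andP[].
  rewrite -(inj_eq val_inj) neq_ltn => /orP[ij|ji]; first exact: H.
  by rewrite rankC; apply: H.
have n0 : (0 < n)%N by apply: leq_trans mn.
(* The edges of [S] are grouped by their smaller end, for which there are [n] choices. *)
have [o oS] : exists o : 'I_n, (packing_bound m <= #|[set j | (o, j) \in S]|)%N.
  have [|o oS] := @pigeonhole _ 'I_n S fst (packing_bound m).-1.
    by rewrite card_ord; apply: leq_trans LS; rewrite ltn_pmul2r.
  exists o; rewrite (leq_trans oS) //.
  rewrite -(card_in_imset (f := snd)) => [|[a b] [c d]]; last first.
    by rewrite !inE /= => /andP[_ /eqP->] /andP[_ /eqP->] ->.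
  apply/subset_leq_card/fintype.subsetP => x /imsetP[[a b]].
  by rewrite !inE /= => /andP[abS /eqP<-] ->.
set J := [set j | (o, j) \in S] in oS.
have /card_gt0P[j0 j0J] : (0 < #|J|)%N by apply: leq_trans oS.
(* The farthest neighbour gives the radius, so that the clique edges are at most as long as the
   short edge [(o, j1)]. *)
have [j1 j1J j1max] : exists2 j1, j1 \in J & {in J, forall j, sqdist q o j <= sqdist q o j1}.
  by case: (arg_maxP (P := mem J) (fun j => sqdist q o j) j0J) => j1; exists j1.
have [A [AJ Acard Ar]] := @crowded_ball _ _ _ q o J _ m0 oS j1max.
have sA (i : 'I_m.+2) : (i < #|A|)%N by apply: leq_trans Acard.
pose s i : 'I_n := enum_val (Ordinal (sA i)).
exists s; split=> [i j /enum_val_inj/(congr1 val)/= ij|i j ij]; first exact: val_inj.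
apply: (@leq_ltn_trans (edge_rank q (o, j1))).
  by apply: edge_rank_le; apply: Ar; exact: enum_valP.
by move: j1J; rewrite !inE => /andP[].
Qed.

(** * Reconstruction *)

(* An assignment that preserves triangles is induced by a map of the points; then
   the first [m.+1] of them are required to be affinely independent. *)
Definition degenerate (R : ringType) m (T : eqType) (d : T -> T -> R)
    (psi : 'I_m.+2 -> 'I_m.+2 -> T * T) : bool :=
  injective_assignment psi &&
  if preserves_triangles psi then \det (gram_base (pullback d psi)) == 0
  else \det (gram_full (pullback d psi)) == 0.

Section GenericConfigurations.
Variables (R : realType) (m n : nat).
Implicit Types p : 'M[R]_(m, n).

Definition distinct_distances p : Prop :=
  forall e f : 'I_n * 'I_n, (e.1 < e.2)%N -> (f.1 < f.2)%N -> e != f ->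
    sqdist p e.1 e.2 != sqdist p f.1 f.2.

Definition short_assignment p (psi : 'I_m.+2 -> 'I_m.+2 -> 'I_n * 'I_n) : Prop :=
  forall i j : 'I_m.+2, (i < j)%N -> ((psi i j).1 < (psi i j).2)%N /\
    (edge_rank p (psi i j) < packing_bound m * n)%N.

Definition based_assignment (psi : 'I_m.+2 -> 'I_m.+2 -> 'I_n * 'I_n) : Prop :=
  exists b : 'I_m.+1 -> 'I_n, forall i j : 'I_m.+1, (i < j)%N ->
    psi (lift ord_max i) (lift ord_max j) = (b i, b j).

(** Assignments are taken from a finite type, so that neighbourhoods and nonvanishing conditions for
    single assignments can be intersected. *)
Definition curry_ffun (psi : {ffun 'I_m.+2 * 'I_m.+2 -> 'I_n * 'I_n}) i j := psi (i, j).

(** Distinct distances make the rank a faithful name of an edge, which lets a program enumerate the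
    short assignments. *)
Definition generic : set 'M[R]_(m, n) := fun p =>
  distinct_distances p /\
  forall psi, short_assignment p (curry_ffun psi) \/ based_assignment (curry_ffun psi) ->
    ~~ degenerate (sqdist p) (curry_ffun psi).

End GenericConfigurations.

(** Up to the factor [c] the pullback is realized by points of R^m, so its full Gram determinant
    vanishes; nondegeneracy then leaves only the branch that preserves triangles. *)
Lemma nondegenerate_realization (R : realType) m n (p q : 'M[R]_(m, n))
    (psi : 'I_m.+2 -> 'I_m.+2 -> 'I_n * 'I_n) (s : 'I_m.+2 -> 'I_n) c :
  injective_assignment psi -> ~~ degenerate (sqdist p) psi ->
  (forall i j, pullback (sqdist p) psi i j = c * sqdist q (s i) (s j)) ->
  preserves_triangles psi /\ \det (gram_base (pullback (sqdist p) psi)) != 0.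
Proof.
rewrite /degenerate => -> /= + dE; case: ifP => // _.
by rewrite /gram_full (eq_gram _ _ dE) gram_sqdist_singular eqxx.
Qed.

Section Reconstruction.
Variables (R : realType) (m n : nat) (p q : 'M[R]_(m, n)).
Variables (phi : 'I_n -> 'I_n -> 'I_n * 'I_n) (c : R).
Hypotheses (m0 : (0 < m)%N) (mn : (m.+2 <= n)%N) (c0 : 0 < c).
Hypothesis phiC : forall x y, phi x y = phi y x.
Hypothesis phi_lt : forall x y, x != y -> ((phi x y).1 < (phi x y).2)%N.
Hypothesis phi_inj : forall x y z t, x != y -> z != t ->
  edge_eq (phi x y) (phi z t) -> edge_eq (x, y) (z, t).
Hypothesis phi_rank : forall x y, x != y -> (edge_rank p (phi x y) <= edge_rank q (x, y))%N.
Hypothesis phi_dist : forall x y, x != y ->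
  sqdist p (phi x y).1 (phi x y).2 = c * sqdist q x y.
Hypothesis p_generic : generic p.

Lemma phi_neq x y : x != y -> (phi x y).1 != (phi x y).2.
Proof. by move=> xy; rewrite -(inj_eq val_inj) neq_ltn phi_lt. Qed.

Lemma sub_assignment (s : 'I_m.+2 -> 'I_n) (psi : 'I_m.+2 -> 'I_m.+2 -> 'I_n * 'I_n) :
  injective s ->
  (forall i j, i != j -> edge_eq (sym_assignment psi i j) (phi (s i) (s j))) ->
  injective_assignment psi /\
  forall i j, pullback (sqdist p) psi i j = c * sqdist q (s i) (s j).
Proof.
move=> s_inj psiE; split.
  apply/injective_assignmentP; split=> [i j ij|i j k l ij kl e].
    have sij : s i != s j by rewrite (inj_eq s_inj).
    have := psiE i j ij; case: (phi _ _) (phi_neq sij) => a b /= ab.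
    by case/edge_eqP => ->; rewrite //= eq_sym.
  have : edge_eq (phi (s i) (s j)) (phi (s k) (s l)).
    rewrite edge_eq_sym in e; apply: edge_eq_trans (psiE _ _ kl); rewrite edge_eq_sym.
    by apply: edge_eq_trans e (psiE _ _ ij).
  rewrite -[_ (i, j) _]/(edge_eq _ _) => /phi_inj; rewrite !(inj_eq s_inj) => /(_ ij kl).
  by move=> /edge_eqP[[/s_inj-> /s_inj->]|[/s_inj-> /s_inj->]]; apply/edge_eqP; auto.
move=> i j; rewrite /pullback; case: eqVneq => [->|ij]; first by rewrite sqdist_refl mulr0.
by rewrite (sqdist_edge_eq _ (psiE _ _ ij)) phi_dist // (inj_eq s_inj).
Qed.

(** The edges of a short clique of [q] have images of no larger rank in [p], so [phi] restricts to a
    short assignment, which genericity of [p] controls. *)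
Lemma clique_image : exists (s b : 'I_m.+2 -> 'I_n), [/\ injective s, injective b,
  forall i j, i != j -> edge_eq (phi (s i) (s j)) (b i, b j) &
  \det (gram_base (fun i j => sqdist p (b i) (b j))) != 0].
Proof.
have [s [s_inj s_short]] := short_clique q m0 mn.
pose psi : {ffun 'I_m.+2 * 'I_m.+2 -> 'I_n * 'I_n} := [ffun e => phi (s e.1) (s e.2)].
have psiE i j : i != j -> sym_assignment (curry_ffun psi) i j = phi (s i) (s j).
  by rewrite /sym_assignment /curry_ffun !ffunE; case: ifP => // _ _; rewrite phiC.
have [|psi_inj dE] := sub_assignment s_inj (psi := curry_ffun psi).
  by move=> i j ij; rewrite psiE // edge_eq_refl.
have nd : ~~ degenerate (sqdist p) (curry_ffun psi).
  apply: p_generic.2; left => i j ij; rewrite /curry_ffun ffunE /=.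
  have nij : i != j by rewrite -(inj_eq val_inj) neq_ltn ij.
  have sij : s i != s j by rewrite (inj_eq s_inj).
  split; first exact: phi_lt.
  by apply: leq_ltn_trans (phi_rank sij) (s_short _ _ nij).
have [tri det0] := nondegenerate_realization psi_inj nd dE.
have [b [b_inj bE]] := induced_assignment (m0 : 2 < m.+2)%N psi_inj tri.
exists s, b; split => // [i j ij|]; first by rewrite -psiE //; exact: bE.
by congr (\det _ != 0): det0; apply: eq_gram => i j; rewrite (pullback_induced _ _ _ bE).
Qed.

Lemma third_index (i j : 'I_m.+2) : exists h, (h != i) && (h != j).
Proof.
have /subsetPn[h _] : ~~ ([set: 'I_m.+2] \subset [set i; j]).
  apply/negP => /subset_leq_card; rewrite cardsT card_ord cards2.
  by case: (_ != _) => /=; move: m0; lia.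
by rewrite !inE negb_or => ?; exists h.
Qed.

Section Extension.
Variables (s b : 'I_m.+2 -> 'I_n).
Hypotheses (s_inj : injective s) (b_inj : injective b).
Hypothesis bE : forall i j, i != j -> edge_eq (phi (s i) (s j)) (b i, b j).

(** Dropping from the clique a vertex [h] other than [i] and [j], and adding [x], gives [m.+2]
    points that carry a based assignment; by genericity it preserves triangles. *)
Lemma outer_triangle x i j : (forall i, s i != x) -> i != j ->
  triangular (phi (s i) (s j)) (phi (s i) x) (phi (s j) x).
Proof.
move=> sx ij; have [h /andP[hi hj]] := third_index i j.
pose pt k := if unlift ord_max k is Some k' then s (lift h k') else x.
have ptl k : pt (lift ord_max k) = s (lift h k) by rewrite /pt liftK.
have ptx : pt ord_max = x by rewrite /pt unlift_none.
have pt_inj : injective pt.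
  move=> k l; case: (unliftP ord_max k) => [k'|] ->; case: (unliftP ord_max l) => [l'|] ->;
    rewrite ?ptl ?ptx //.
  - by move=> /s_inj/lift_inj->.
  - by move/eqP; rewrite (negPf (sx _)).
  - by move/esym/eqP; rewrite (negPf (sx _)).
(* Between clique points [phi] is replaced by the same edge in the orientation that
   [based_assignment] prescribes. *)
pose psi : {ffun 'I_m.+2 * 'I_m.+2 -> 'I_n * 'I_n} := [ffun e =>
  if (unlift ord_max e.1, unlift ord_max e.2) is (Some k, Some l)
  then (b (lift h k), b (lift h l)) else phi (pt e.1) (pt e.2)].
have psiE k l : k != l -> edge_eq (sym_assignment (curry_ffun psi) k l) (phi (pt k) (pt l)).
  have H k' l' : k' != l' -> edge_eq (curry_ffun psi k' l') (phi (pt k') (pt l')).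
    rewrite /curry_ffun ffunE /=.
    case: (unliftP ord_max k') => [k1|] ->; last by rewrite edge_eq_refl.
    case: (unliftP ord_max l') => [l1|] ->; last by rewrite edge_eq_refl.
    by rewrite !ptl (inj_eq lift_inj) => kl; rewrite edge_eq_sym bE // (inj_eq lift_inj).
  by rewrite /sym_assignment; case: ifP => _ kl; [exact: H | rewrite phiC H // eq_sym].
have [psi_inj dE] := sub_assignment pt_inj psiE.
have nd : ~~ degenerate (sqdist p) (curry_ffun psi).
  apply: p_generic.2; right; exists (b \o lift h) => k l _.
  by rewrite /curry_ffun ffunE /= !liftK.
have [/preserves_trianglesP tri _] := nondegenerate_realization psi_inj nd dE.
have lifted k : h != k -> exists k', k = lift h k'.
  by case: (unliftP h k) => [k' ->|->]; [exists k' | rewrite eqxx].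
have [i' iE] := lifted _ hi; have [j' jE] := lifted _ hj.
have := tri (lift ord_max i') (lift ord_max j') ord_max.
have ij' : i' != j' by rewrite -(inj_eq (lift_inj (h := h))) -iE -jE.
rewrite (inj_eq lift_inj) ![lift _ _ == ord_max]eq_sym !neq_lift => /(_ ij' isT isT).
move/(triangular_eq (psiE _ _ _)); rewrite (inj_eq lift_inj) => /(_ ij').
move=> /triangularCA/(triangular_eq (psiE _ _ _)); rewrite eq_sym neq_lift => /(_ isT).
move=> /triangularCA/triangularAC/triangularCA/(triangular_eq (psiE _ _ _)).
rewrite eq_sym neq_lift => /(_ isT) /triangularCA/triangularAC.
by rewrite !ptl ptx -iE -jE.
Qed.

(** A clique point goes to its known image. Otherwise three clique points determine [x'] by
    [extend_triangle], and the edge from any other [s i] is the third side of a triangle at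
    [b i0]. *)
Lemma extend_point x : exists x', forall i, s i != x -> edge_eq (phi (s i) x) (b i, x').
Proof.
have [[j jx]|sx] := pselect (exists j, s j = x).
  by exists (b j) => i; rewrite -jx (inj_eq s_inj); exact: bE.
have {}sx i : s i != x by apply/eqP => ix; apply: sx; exists i.
have bneq i j : i != j -> b i != b j by rewrite (inj_eq b_inj).
have new k i j : i != j -> ~~ edge_eq (phi (s k) x) (b i, b j).
  move=> ij; apply/negP => e.
  have : edge_eq (phi (s k) x) (phi (s i) (s j)).
    by apply: edge_eq_trans e _; rewrite edge_eq_sym bE.
  move/phi_inj; rewrite (inj_eq s_inj) => /(_ (sx _) ij) /edge_eqP[[_ xs]|[_ xs]].
    by have := sx j; rewrite xs eqxx.
  by have := sx i; rewrite xs eqxx.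
have tri i j : i != j -> triangular (b i, b j) (phi (s i) x) (phi (s j) x).
  by move=> ij; apply: triangular_eq (bE ij) _; exact: outer_triangle.
pose i0 : 'I_m.+2 := ord0; pose i1 : 'I_m.+2 := lift ord0 ord0.
have n01 : i0 != i1 by [].
have [i2 /andP[n20 n21]] := third_index i0 i1.
rewrite eq_sym in n20; rewrite eq_sym in n21.
have [|x' [e0 e1 e2]] := extend_triangle (bneq _ _ n01) (bneq _ _ n20) (bneq _ _ n21)
  _ (tri _ _ n01) (tri _ _ n20) (tri _ _ n21).
  by move=> e; rewrite !inE => /or3P[] /eqP->; split; exact: new.
exists x' => i _; have [->//|i0n] := eqVneq i i0.
have bx : b i != x'.
  by apply: contraNneq (new i0 i0 i _) => [->//|]; rewrite eq_sym.
apply: third_edge (_ : b i0 != b i) bx (edge_eq_refl _) e0 (tri _ _ _); last by rewrite eq_sym.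
by rewrite (inj_eq b_inj) eq_sym.
Qed.

End Extension.

Lemma reconstruction : same_up_to_similarity_and_relabeling p q.
Proof.
have [s [b [s_inj b_inj bE det0]]] := clique_image.
have [g gE] := choice (extend_point s_inj b_inj bE).
have other (x y : 'I_n) : exists i, (s i != x) && (s i != y).
  have /subsetPn[z /imsetP[i _ ->]] : ~~ ([set s i | i in 'I_m.+2] \subset [set x; y]).
    apply/negP => /subset_leq_card; rewrite card_imset // card_ord cards2.
    by case: (_ != _) => /=; move: m0; lia.
  by rewrite !inE negb_or => ?; exists i.
have gs i : g (s i) = b i.
  have [h /andP[hi _]] := third_index i i.
  have shi : s h != s i by rewrite (inj_eq s_inj).
  exact: edge_eq_cancel (gE _ _ shi) (bE _ _ hi).
have g_inj : injective g.
  move=> x y gxy; have [i /andP[ix iy]] := other x y; apply/eqP/negPn/negP => xy.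
  have := gE x i ix; rewrite gxy => ex; have := gE y i iy; rewrite edge_eq_sym => ey.
  have := edge_eq_trans ex ey; move/phi_inj => /(_ ix iy) /edge_eqP[[xy']|[iy' _]].
    by rewrite xy' eqxx in xy.
  by rewrite iy' eqxx in iy.
have dq x i : sqdist q x (s i) = c^-1 * sqdist p (g x) (b i).
  have [<-|ix] := eqVneq (s i) x; first by rewrite gs !sqdist_refl mulr0.
  rewrite sqdistC [sqdist p _ _]sqdistC -(sqdist_edge_eq _ (gE _ _ ix)).
  by rewrite phi_dist // mulKf // gt_eqF.
have [|M [T [mu [MM mu0 H]]]] := congruent_extension _ det0 gs dq; first by rewrite invr_gt0.
(* [g] leads from the points of [q] to those of [p], opposite to the relabeling sought. *)
exists M, T, mu, (perm g_inj)^-1%g; split => // i.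
by rewrite -H -[in X in col X p](permKV (perm g_inj) i) permE.
Qed.

End Reconstruction.

Theorem generic_determined (R : realType) m n (p : 'M[R]_(m, n)) :
  (0 < m)%N -> (m.+2 <= n)%N -> not_all_equal p -> generic p ->
  determined_by_rescaled_distances p.
Proof.
move=> m0 mn p_neq p_gen q q_neq /perm_eq_image_bijection[f [fP f_inj fE]].
have dp0 := dmax_gt0 p_neq; have dq0 := dmax_gt0 q_neq.
pose c := dmax p / dmax q.
have c0 : 0 < c by rewrite divr_gt0.
have dE (e : 'I_n * 'I_n) : e \in @pairs n -> sqdist p (f e).1 (f e).2 = c * sqdist q e.1 e.2.
  by move=> /fE /(canLR (divfK _)) -/(_ (lt0r_neq0 dp0)) <-; rewrite /c mulrAC -mulrA mulrC.
have f_surj (e : 'I_n * 'I_n) : e \in @pairs n -> exists2 e', e' \in @pairs n & e = f e'.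
  have : f @: [set e in @pairs n] == [set e in @pairs n].
    rewrite eqEcard card_in_imset => [|x y]; last by rewrite !inE; exact: f_inj.
    rewrite leqnn andbT; apply/fintype.subsetP => y /imsetP[x]; rewrite inE => xP ->.
    by rewrite inE; exact: fP.
  move=> /eqP fS eP; have : e \in f @: [set e in @pairs n] by rewrite fS inE.
  by move=> /imsetP[e']; rewrite inE => e'P ->; exists e'.
pose phi (x y : 'I_n) := if (x < y)%N then f (x, y) else f (y, x).
have phi_cases (x y : 'I_n) : x != y ->
    exists2 e, e \in @pairs n & phi x y = f e /\ edge_eq e (x, y).
  rewrite -(inj_eq val_inj) neq_ltn /phi; case: ltnP => /= [xy _|_ yx].
    by exists (x, y); rewrite ?edge_eq_refl.
  by exists (y, x); rewrite // edge_eqC edge_eq_refl.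
apply: (@reconstruction R m n p q phi c) => //.
- by move=> x y; rewrite /phi; case: ltngtP => // /val_inj->.
- by move=> x y /phi_cases[e eP [-> _]]; exact: fP.
- move=> x y z t /phi_cases[e eP [-> exy]] /phi_cases[e' e'P [-> ezt]] fe.
  suff ee : e = e' by rewrite edge_eq_sym in exy; apply: edge_eq_trans exy _; rewrite ee.
  apply: f_inj => //; have := fP _ eP; have := fP _ e'P.
  move: fe; case: (f e) (f e') => [a b] [a' b'] /edge_eqP[//|[-> ->]].
  by rewrite !inE /= => h /(ltn_trans h); rewrite ltnn.
- move=> x y /phi_cases[e eP [-> exy]].
  have -> : edge_rank q (x, y) = edge_rank q e.
    by apply/eqP; rewrite eqn_leq !edge_rank_le // (sqdist_edge_eq _ exy).
  (* [f] is onto and scales all squared distances by [c], so each edge of [p] shorter than [f e] is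
     the image of an edge of [q] shorter than [e]. *)
  apply: leq_trans (leq_imset_card f _); apply/subset_leq_card/fintype.subsetP => g.
  rewrite !inE => /andP[gP]; have [g' g'P ->] := f_surj g gP.
  rewrite !dE // ltr_pM2l // => lt_e.
  by apply/imsetP; exists g'; rewrite // inE lt_e andbT.
- by move=> x y /phi_cases[e eP [-> exy]]; rewrite dE // (sqdist_edge_eq _ exy).
Qed.

(** * Openness and density *)

Section PolynomialMaps.
Variables (R : realType) (m n : nat).
Implicit Types (p w : 'M[R]_(m, n)) (F G : 'M[R]_(m, n) -> R).

(* For density it is enough to be polynomial along every line. *)
Definition polynomial_map F : Prop :=
  continuous F /\
  forall p w, exists P : {poly R}, forall t, F (p + t *: w) = P.[t].

Lemma polynomial_map_cst a : polynomial_map (fun=> a).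
Proof.
split; first exact: cst_continuous.
by move=> p w; exists a%:P => t; rewrite hornerC.
Qed.

Lemma polynomial_map_coord i j : polynomial_map (fun p => p i j).
Proof.
split; first exact: coord_continuous.
move=> p w; exists ((p i j)%:P + (w i j)%:P * 'X) => t.
by rewrite !hornerE !mxE mulrC.
Qed.

Lemma polynomial_map_add F G :
  polynomial_map F -> polynomial_map G -> polynomial_map (fun p => F p + G p).
Proof.
move=> [cF pF] [cG pG]; split=> [x|p w]; first exact: continuousD (cF x) (cG x).
have [P PE] := pF p w; have [Q QE] := pG p w.
by exists (P + Q) => t; rewrite hornerD PE QE.
Qed.

Lemma polynomial_map_mul F G :
  polynomial_map F -> polynomial_map G -> polynomial_map (fun p => F p * G p).
Proof.
move=> [cF pF] [cG pG]; split=> [x|p w]; first exact: continuousM (cF x) (cG x).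
have [P PE] := pF p w; have [Q QE] := pG p w.
by exists (P * Q) => t; rewrite hornerM PE QE.
Qed.

Lemma polynomial_map_opp F : polynomial_map F -> polynomial_map (fun p => - F p).
Proof.
move=> pF; have := polynomial_map_mul (polynomial_map_cst (-1)) pF.
by under [X in polynomial_map X -> _]eq_fun do rewrite mulN1r.
Qed.

Lemma polynomial_map_sum I (r : seq I) (P : pred I) (F : I -> 'M[R]_(m, n) -> R) :
  (forall i, polynomial_map (F i)) -> polynomial_map (fun p => \sum_(i <- r | P i) F i p).
Proof.
move=> pF; elim: r => [|i r IH].
  by under eq_fun do rewrite big_nil; exact: polynomial_map_cst.
under eq_fun do rewrite big_cons; case: (P i) => //; exact: polynomial_map_add.
Qed.

Lemma polynomial_map_prod I (r : seq I) (P : pred I) (F : I -> 'M[R]_(m, n) -> R) :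
  (forall i, polynomial_map (F i)) -> polynomial_map (fun p => \prod_(i <- r | P i) F i p).
Proof.
move=> pF; elim: r => [|i r IH].
  by under eq_fun do rewrite big_nil; exact: polynomial_map_cst.
under eq_fun do rewrite big_cons; case: (P i) => //; exact: polynomial_map_mul.
Qed.

Lemma polynomial_map_det k (A : 'M[R]_(m, n) -> 'M[R]_k) :
  (forall i j, polynomial_map (fun p => A p i j)) -> polynomial_map (fun p => \det (A p)).
Proof.
move=> pA; apply: polynomial_map_sum => s.
by apply: polynomial_map_mul; [exact: polynomial_map_cst | exact: polynomial_map_prod].
Qed.

Lemma polynomial_map_sqdist i j : polynomial_map (fun p => sqdist p i j).
Proof.
apply: polynomial_map_sum => k.
have pB : polynomial_map (fun p => p k i - p k j).
  by apply: polynomial_map_add; [|apply: polynomial_map_opp]; exact: polynomial_map_coord.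
exact: polynomial_map_mul.
Qed.

Lemma polynomial_map_gram v (psi : 'I_v -> 'I_v -> 'I_n * 'I_n) o k (f : 'I_k -> 'I_v) :
  polynomial_map (fun p => \det (gram (pullback (sqdist p) psi) o f)).
Proof.
have pP i j : polynomial_map (fun p => pullback (sqdist p) psi i j).
  rewrite /pullback; case: eqVneq => _; first exact: polynomial_map_cst.
  exact: polynomial_map_sqdist.
apply: polynomial_map_det => i j; under eq_fun do rewrite mxE.
apply: polynomial_map_add; last by apply: polynomial_map_opp.
exact: polynomial_map_add.
Qed.

Lemma nonvanishing_near F p : polynomial_map F -> F p != 0 -> \forall q \near p, F q != 0.
Proof. by move=> [cF _] Fp; exact: (cvgr_neq0 _ (cF p) Fp). Qed.

(** On the line from a point of [O] towards a nonzero of [F], the map is a nonzero polynomial with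
    finitely many roots, whereas [O] contains a whole interval of the line. *)
Lemma nonvanishing_meets F (O : set 'M[R]_(m, n)) :
  polynomial_map F -> (exists w, F w != 0) -> open O -> (O !=set0)%classic ->
  exists2 p, O p & F p != 0.
Proof.
move=> [cF pF] [w Fw] Oopen [p Op].
have [P PE] := pF p (w - p).
have P0 : P != 0.
  by apply: contraNneq Fw => P0; rewrite -[w](subrK p) addrC -[w - p]scale1r PE P0 horner0.
have line_cont : continuous (fun t : R => p + t *: (w - p)).
  move=> t; apply: (@continuousD R 'M[R]_(m, n) R (fun=> p) (fun t => t *: (w - p)) t).
    exact: cst_continuous.
  exact: scalel_continuous.
have /nbhs_ballP[e /= e0 He] : nbhs (0 : R) [set t | O (p + t *: (w - p))]%classic.
  by apply: line_cont; rewrite scale0r addr0; exact: open_nbhs_nbhs.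
(* These are [size P] parameters, more than [P] has roots; denominators from 2 on keep them strictly
   inside the ball of radius [e]. *)
pose ts := [seq e / k.+2%:R | k <- iota 0 (size P)].
have ts_uniq : uniq ts.
  rewrite map_inj_uniq ?iota_uniq // => k l /(mulfI (lt0r_neq0 e0))/invr_inj/eqP.
  by rewrite eqr_nat => /eqP[].
have : ~~ all (root P) ts.
  by apply: contraL (leqnn (size P)) => roots; rewrite -ltnNge;
    have := max_poly_roots P0 roots ts_uniq; rewrite size_map size_iota.
move=> /allPn[_ /mapP[k _ ->] Pk]; exists (p + (e / k.+2%:R) *: (w - p)).
  apply: He; rewrite /ball /= sub0r normrN ger0_norm ?divr_ge0 // 1?ltW //.
  by rewrite ltr_pdivrMr // ltr_pMr // ltr1n.
by rewrite PE.
Qed.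

Lemma nonvanishing_dense (I : finType) (F : I -> 'M[R]_(m, n) -> R) :
  (forall i, polynomial_map (F i)) -> (forall i, exists w, F i w != 0) ->
  dense [set p | forall i, F i p != 0]%classic.
Proof.
move=> pF wF O O0 Oopen.
suff [p [Op Fp]] : exists p, O p /\ forall i, i \in enum I -> F i p != 0.
  by exists p; split => // i; apply: Fp; rewrite mem_enum.
elim: (enum I) O O0 Oopen => [|i s IH] O O0 Oopen.
  by case: O0 => p Op; exists p.
have [p Op Fp] := nonvanishing_meets (pF i) (wF i) Oopen O0.
have [||p' [[Op' Fp'] sp']] := IH (O `&` [set p | F i p != 0])%classic.
- by exists p.
- apply: openI => //; rewrite openE => x; exact: nonvanishing_near.
by exists p'; split => // j; rewrite inE => /orP[/eqP->|/sp'].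
Qed.

Lemma distinct_distances_near p : distinct_distances p -> \forall q \near p, distinct_distances q.
Proof.
move=> dp; rewrite /distinct_distances.
apply: (filter_forall (nbhs_filter p)) => e; apply: (filter_forall (nbhs_filter p)) => f.
have [ef|] := boolP [&& (e.1 < e.2)%N, (f.1 < f.2)%N & e != f]; last first.
  move=> nef; apply: nearW => q e12 f12 ef; move: nef; by rewrite e12 f12 ef.
case/and3P: ef => e12 f12 ef; have := dp _ _ e12 f12 ef; rewrite -subr_eq0 => d0.
have : polynomial_map (fun p => sqdist p e.1 e.2 - sqdist p f.1 f.2).
  by apply: polynomial_map_add; [|apply: polynomial_map_opp]; exact: polynomial_map_sqdist.
by move=> /nonvanishing_near-/(_ _ d0); apply: filterS => q; rewrite subr_eq0.
Qed.

Lemma nondegenerate_near (psi : 'I_m.+2 -> 'I_m.+2 -> 'I_n * 'I_n) p :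
  ~~ degenerate (sqdist p) psi -> \forall q \near p, ~~ degenerate (sqdist q) psi.
Proof.
rewrite /degenerate; case: (injective_assignment psi); last first.
  by move=> _; apply: (@nearW _ (nbhs p)) => q; rewrite andFb.
by case: ifP => _; apply: (@nonvanishing_near (fun p => \det _)); exact: polynomial_map_gram.
Qed.

Lemma edge_rank_near p e : \forall q \near p, (edge_rank p e <= edge_rank q e)%N.
Proof.
suff : \forall q \near p, forall f, sqdist p f.1 f.2 < sqdist p e.1 e.2 ->
    sqdist q f.1 f.2 < sqdist q e.1 e.2.
  apply: filterS => q H; apply/subset_leq_card/fintype.subsetP => f; rewrite !inE.
  by move=> /andP[-> /H].
apply: (filter_forall (nbhs_filter p)) => f.
have [lt_fe|_] := boolP (sqdist p f.1 f.2 < sqdist p e.1 e.2); last by apply: nearW => q.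
have [cD _] : polynomial_map (fun p => sqdist p e.1 e.2 - sqdist p f.1 f.2).
  by apply: polynomial_map_add; [|apply: polynomial_map_opp]; exact: polynomial_map_sqdist.
have := cvgr_gt (F := nbhs p) _ (cD p) 0; rewrite subr_gt0 => /(_ (nbhs_filter p) lt_fe).
by apply: filterS => q; rewrite subr_gt0.
Qed.

(** An assignment that is degenerate at [p] is not short for [p]; ranks nearby are no smaller, so it
    is not short there either, and being based does not depend on the point. *)
Lemma generic_open : open (@generic R m n).
Proof.
rewrite openE => p [dp gp].
suff : \forall q \near p, distinct_distances q /\ forall psi,
  short_assignment q (curry_ffun psi) \/ based_assignment (curry_ffun psi) ->
    ~~ degenerate (sqdist q) (curry_ffun psi) by [].
apply: filterI; first exact: distinct_distances_near.
apply: (filter_forall (nbhs_filter p)) => psi.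
have [deg|nd] := boolP (degenerate (sqdist p) (curry_ffun psi)); last first.
  by apply: filterS (nondegenerate_near nd) => q.
have {gp} [nshort nbased] : ~ short_assignment p (curry_ffun psi) /\
    ~ based_assignment (curry_ffun psi).
  by split=> H; have := gp psi; rewrite deg; [move/(_ (or_introl H))|move/(_ (or_intror H))].
suff : \forall q \near p, ~ short_assignment q (curry_ffun psi).
  by apply: filterS => q nq [].
suff : \forall q \near p, forall i j : 'I_m.+2,
    (edge_rank p (curry_ffun psi i j) <= edge_rank q (curry_ffun psi i j))%N.
  apply: filterS => q H sq; apply: nshort => i j ij; have [? ?] := sq i j ij.
  by split => //; apply: leq_ltn_trans (H i j) _.
apply: (filter_forall (nbhs_filter p)) => i; apply: (filter_forall (nbhs_filter p)) => j.
exact: edge_rank_near.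
Qed.

(** All assignments, short or not, are made nondegenerate; each gives one polynomial, with the
    constant 1 where nothing is required. *)
Lemma generic_dense : (0 < m)%N -> dense (@generic R m n).
Proof.
move=> m0.
pose I := ((('I_n * 'I_n) * ('I_n * 'I_n)) + {ffun 'I_m.+2 * 'I_m.+2 -> 'I_n * 'I_n})%type.
pose F (i : I) p : R := match i with
  | inl (e, f) => if [&& (e.1 < e.2)%N, (f.1 < f.2)%N & e != f]
                  then sqdist p e.1 e.2 - sqdist p f.1 f.2 else 1
  | inr psi => if injective_assignment (curry_ffun psi) then
      if preserves_triangles (curry_ffun psi)
      then \det (gram_base (pullback (sqdist p) (curry_ffun psi)))
      else \det (gram_full (pullback (sqdist p) (curry_ffun psi))) else 1
  end.
have pF i : polynomial_map (F i).
  case: i => [[e f]|psi]; rewrite /F.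
    case: [&& _, _ & _]; last exact: polynomial_map_cst.
    by apply: polynomial_map_add; [|apply: polynomial_map_opp]; exact: polynomial_map_sqdist.
  case: (injective_assignment _); last exact: polynomial_map_cst.
  by case: (preserves_triangles _); exact: polynomial_map_gram.
have wF i : exists w, F i w != 0.
  case: i => [[e f]|psi]; rewrite /F.
    case: (boolP [&& _, _ & _]) => [/and3P[e12 f12 ef]|_]; last by exists 0; rewrite oner_neq0.
    have [x [xe xf]] : exists x, (x \in [:: e.1; e.2]) /\ (x \notin [:: f.1; f.2]).
      case: (boolP (e.1 \in [:: f.1; f.2])) => [e1f|]; last by exists e.1; rewrite inE eqxx.
      case: (boolP (e.2 \in [:: f.1; f.2])) => [e2f|]; last first.
        by exists e.2; split => //; rewrite !inE eqxx orbT.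
      case: e f ef e12 f12 e1f e2f => [a b] [c d] /= ef ab cd.
      rewrite !in_cons !in_nil !orbF => /orP[]/eqP ae /orP[]/eqP be;
        move: ef ab cd; rewrite ae be ?ltnn ?eqxx //.
      by move=> _ cd /(ltn_trans cd); rewrite ltnn.
    (* Only [x], an end of [e] but not of [f], is moved away from the origin. *)
    exists (\matrix_(_, y) (y == x)%:R).
    have -> : sqdist (\matrix_(_, y) (y == x)%:R : 'M[R]_(m, n)) f.1 f.2 = 0.
      rewrite /sqdist big1 // => k _; rewrite !mxE.
      move: xf; rewrite !inE negb_or ![x == _]eq_sym => /andP[/negPf-> /negPf->].
      by rewrite subrr expr0n.
    have -> : sqdist (\matrix_(_, y) (y == x)%:R : 'M[R]_(m, n)) e.1 e.2 = m%:R.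
      rewrite /sqdist (eq_bigr (fun=> 1)) ?sumr_const ?card_ord // => k _; rewrite !mxE.
      have n12 : e.1 != e.2 by rewrite -(inj_eq val_inj) neq_ltn e12.
      move: xe n12; rewrite !inE ![x == _]eq_sym => /orP[]/eqP->; rewrite eqxx.
        by rewrite eq_sym => /negPf->; rewrite subr0 expr1n.
      by move=> /negPf->; rewrite sub0r sqrrN expr1n.
    by rewrite subr0 pnatr_eq0 -lt0n.
  case: (boolP (injective_assignment _)) => [inj|_]; last by exists 0; rewrite oner_neq0.
  case: (boolP (preserves_triangles _)) => [tri|ntri]; first exact: witness_triangles.
  exact: witness_no_triangle.
have := nonvanishing_dense pF wF.
move=> dF O O0 Oopen; have [p [Op Fp]] := dF O O0 Oopen; exists p; split => //.
split=> [e f e12 f12 ef|psi _].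
  by have := Fp (inl (e, f)); rewrite /= e12 f12 ef subr_eq0.
by have := Fp (inr psi); rewrite /= /degenerate; case: ifP => //= _; case: ifP.
Qed.

End PolynomialMaps.

(** * Programs *)

(** In lexicographic order, the order in which nested loops visit the values of their counters. *)
Fixpoint tuples k B : seq (seq nat) :=
  if k is k'.+1 then [seq i :: l | i <- iota 0 B, l <- tuples k' B] else [:: [::]].

Lemma foldl_map (S U V : Type) (f : S -> V -> S) (h : U -> V) x r :
  foldl f x (map h r) = foldl (fun z u => f z (h u)) x r.
Proof. by elim: r x => //= u r IH x; rewrite IH. Qed.

Lemma eq_foldl (S U : Type) (f g : S -> U -> S) x r :
  (forall z u, f z u = g z u) -> foldl f x r = foldl g x r.
Proof. by move=> fg; elim: r x => //= u r IH x; rewrite fg IH. Qed.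

Lemma mem_tuples k B l : (l \in tuples k B) = (size l == k) && all (fun i => i < B)%N l.
Proof.
elim: k l => [|k IH] l /=; first by rewrite inE; case: l.
apply/allpairsP/idP => [[[i l'] /= [iB]]|].
  move: iB; rewrite mem_iota add0n /= => iB; rewrite IH => /andP[/eqP <- lB] -> /=.
  by rewrite eqxx iB.
case: l => //= i l /andP[lk /andP[iB lB]]; exists (i, l) => /=.
by rewrite mem_iota add0n /= iB IH lB andbT -eqSS lk.
Qed.

Definition cell c := ILoad (IConst c).

Definition loop bnd a (body : program) :=
  Seq (IStore (IConst a) (IConst 0))
    (While (ILt (cell a) bnd) (Seq body (IStore (IConst a) (IAdd (cell a) (IConst 1))))).

Fixpoint nest bnd (body : program) a k :=
  if k is k'.+1 then loop bnd a (nest bnd body a.+1 k') else body.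

(** Setting the counter to 0 takes 3 steps, incrementing it 6; [c] is the cost of the loop test,
    made once more than there are rounds. *)
Fixpoint nest_cost c B T k :=
  if k is k'.+1 then (3 + B * (c + (nest_cost c B T k' + 6)) + c)%N else T.

(** Carrying [c + 6] along turns each level into a multiplication by at most [B.+2]. *)
Lemma nest_cost_le c B T k : (nest_cost c B T k <= B.+2 ^ k * (T + c + 6))%N.
Proof.
suff : (nest_cost c B T k + c + 6 <= B.+2 ^ k * (T + c + 6))%N by lia.
elim: k => [|k IH]; first by rewrite mul1n.
by rewrite expnS -mulnA; apply: leq_trans (leq_mul (leqnn _) IH) => /=; nia.
Qed.

Section NestCorrectness.
Variables (R : realType) (X : Type) (body : program) (bnd : iexp) (a0 K B T : nat).
Variables (inv : state R -> X -> Prop) (step : X -> seq nat -> X).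
Hypothesis inv_store : forall s x y w, (a0 <= y < a0 + K)%N -> inv s x -> inv (istore s y w) x.
Hypothesis inv_bound : forall s x, inv s x -> ieval s bnd = B.
Hypothesis body_exec : forall s x l, inv s x -> l \in tuples K B ->
  (forall k, (k < K)%N -> imem s (a0 + k) = nth 0%N l k) ->
  exists s' t, [/\ exec body s s' t, (t <= T)%N, inv s' (step x l) &
    forall k, (k < K)%N -> imem s' (a0 + k) = imem s (a0 + k)].

(** The induction needs the values [l0] of the enclosing counters: the inner loops run the body on
    all extensions of [l0] and must leave these counters unchanged. *)
Lemma nest_exec_prefix k l0 s x : (size l0 + k = K)%N -> all (fun i => i < B)%N l0 ->
  inv s x -> (forall j, (j < size l0)%N -> imem s (a0 + j) = nth 0%N l0 j) ->
  exists s' t, [/\ exec (nest bnd body (a0 + size l0) k) s s' t,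
    (t <= nest_cost (icost bnd + 3) B T k)%N,
    inv s' (foldl (fun x l => step x (l0 ++ l)) x (tuples k B)) &
    forall j, (j < size l0)%N -> imem s' (a0 + j) = imem s (a0 + j)].
Proof.
elim: k l0 s x => [|k IH] l0 s x l0K l0B sx s_l0.
  rewrite addn0 in l0K.
  have [|k kK|s' [t [es' tT sx' s's]]] := body_exec (l := l0) sx.
  - by rewrite mem_tuples l0K eqxx.
  - by apply: s_l0; rewrite l0K.
  - by exists s', t; split; rewrite //= ?cats0 // => j; rewrite l0K; exact: s's.
set a := (a0 + size l0)%N.
pose W := While (ILt (cell a) bnd)
  (Seq (nest bnd body a.+1 k) (IStore (IConst a) (IAdd (cell a) (IConst 1)))).
pose c := (icost bnd + 3)%N.
have a_range : (a0 <= a < a0 + K)%N by rewrite /a; lia.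
(* [i] rounds are done and [d] remain. *)
have loop_exec d i s1 x1 : (i + d)%N = B -> inv s1 x1 -> imem s1 a = i ->
    (forall j, (j < size l0)%N -> imem s1 (a0 + j) = nth 0%N l0 j) ->
  exists s' t, [/\ exec W s1 s' t, (t <= d * (c + (nest_cost c B T k + 6)) + c)%N,
    inv s' (foldl (fun x l => step x (l0 ++ l)) x1 [seq i :: l | i <- iota i d, l <- tuples k B]) &
    forall j, (j < size l0)%N -> imem s' (a0 + j) = nth 0%N l0 j].
  elim: d i s1 x1 => [|d IHd] i s1 x1 idB sx1 s1a s1_l0.
    exists s1; eexists; split; [apply: exec_While_stop| |exact: sx1|exact: s1_l0].
      by rewrite /= s1a (inv_bound sx1) -idB addn0 ltnn.
    by rewrite /c /=; lia.
  have [||j|s2 [t2 [e2 t2le sx2 s2_l0]]] := IH (rcons l0 i) s1 x1 _ _ sx1.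
  - by rewrite size_rcons -l0K addSnnS.
  - by rewrite all_rcons l0B andbT -idB; lia.
  - rewrite size_rcons ltnS leq_eqVlt nth_rcons => /orP[/eqP->|jl].
      by rewrite ltnn eqxx s1a.
    by rewrite jl s1_l0.
  rewrite size_rcons addnS -/a in e2 s2_l0.
  have s2a : imem s2 a = i by rewrite -s1a s2_l0.
  pose s3 := istore s2 a i.+1.
  have [||||s' [t' [e' t'le sx' s'_l0]]] := IHd i.+1 s3
    (foldl (fun x l => step x (rcons l0 i ++ l)) x1 (tuples k B)).
  - by rewrite addSnnS.
  - exact: inv_store.
  - by rewrite /s3 /= eqxx.
  - move=> j jl; rewrite /s3 /= eqn_add2l; case: eqP => [jE|_]; first by lia.
    by rewrite s2_l0 ?s1_l0 // ltnS ltnW.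
  exists s'; eexists; split; last exact: s'_l0.
  - apply: exec_While_step; last exact: e'.
      by rewrite /= s1a (inv_bound sx1) -idB; lia.
    apply: exec_Seq e2 _.
    have -> : s3 = istore s2 (ieval s2 (IConst a)) (ieval s2 (IAdd (cell a) (IConst 1))).
      by rewrite /s3 /= s2a addn1.
    exact: exec_IStore.
  - by rewrite /c /= in t'le t2le *; lia.
  rewrite /= foldl_cat foldl_map.
  by under [X in foldl _ X]eq_foldl do rewrite -cat_rcons.
pose s1 := istore s a 0.
have [||||s' [t' [e' t'le sx' s'_l0]]] := loop_exec B 0%N s1 x.
- by [].
- exact: inv_store.
- by rewrite /s1 /= eqxx.
- move=> j jl; rewrite /s1 /= eqn_add2l; case: eqP => [jE|_]; first by lia.
  exact: s_l0.
exists s'; eexists; split; [|  |exact: sx'|by move=> j jl; rewrite s'_l0 ?s_l0].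
  apply: exec_Seq e'.
  have -> : s1 = istore s (ieval s (IConst a)) (ieval s (IConst 0)) by [].
  exact: exec_IStore.
by rewrite /= -/c; lia.
Qed.

Lemma nest_exec s x : inv s x ->
  exists s' t, [/\ exec (nest bnd body a0 K) s s' t,
    (t <= B.+2 ^ K * (T + icost bnd + 9))%N & inv s' (foldl step x (tuples K B))].
Proof.
move=> sx; have [//|s' [t [e' tle sx' _]]] := @nest_exec_prefix K [::] s x erefl isT sx.
exists s', t; rewrite addn0 in e'; split => //.
apply: leq_trans tle _; apply: leq_trans (nest_cost_le _ _ _ _) _.
by rewrite leq_mul2l; apply/orP; right; lia.
Qed.

End NestCorrectness.

(** * Boolean combinations of tests and unrolled expressions *)

Inductive form :=
  | FTrue
  | FTest of test
  | FNot of form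
  | FAnd of form & form
  | FOr of form & form.

(** Tests have no connectives, so a formula becomes a tree of conditionals. Copying [P] and [Q]
    enlarges the program but not the running time, as each occurrence of a test is reached at most
    once. *)
Fixpoint branch f (P Q : program) :=
  match f with
  | FTrue => P
  | FTest b => If b P Q
  | FNot f => branch f Q P
  | FAnd f g => branch f (branch g P Q) Q
  | FOr f g => branch f P (branch g P Q)
  end.

Fixpoint fcost f :=
  match f with
  | FTrue => 0%N
  | FTest b => tcost b
  | FNot f => fcost f
  | FAnd f g | FOr f g => (fcost f + fcost g)%N
  end.

Section Forms.
Variable R : realType.
Implicit Type s : state R.

Fixpoint feval s f :=
  match f with
  | FTrue => true
  | FTest b => teval s b
  | FNot f => ~~ feval s f
  | FAnd f g => feval s f && feval s g
  | FOr f g => feval s f || feval s g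
  end.

Lemma exec_branch f P Q s s' t : exec (if feval s f then P else Q) s s' t ->
  exists2 t', exec (branch f P Q) s s' t' & (t' <= fcost f + t)%N.
Proof.
elim: f P Q t => [|b|f IHf|f IHf g IHg|f IHf g IHg] P Q t /=.
- by exists t.
- by exists (tcost b + t)%N => //; apply: exec_If.
- by move=> e; apply: IHf; move: e; case: (feval s f).
- move=> e; have [t1 e1 t1le] : exists2 t1, exec (if feval s f then branch g P Q else Q) s s' t1 &
      (t1 <= fcost g + t)%N.
    by move: e; case: (feval s f) => /= [/IHg //|e]; exists t; rewrite ?leq_addl.
  by have [t2 e2 t2le] := IHf _ _ _ e1; exists t2 => //; lia.
- move=> e; have [t1 e1 t1le] : exists2 t1, exec (if feval s f then P else branch g P Q) s s' t1 &
      (t1 <= fcost g + t)%N.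
    by move: e; case: (feval s f) => /= [e|/IHg //]; exists t; rewrite ?leq_addl.
  by have [t2 e2 t2le] := IHf _ _ _ e1; exists t2 => //; lia.
Qed.

Definition fall (T : finType) (F : T -> form) := foldr FAnd FTrue (map F (enum T)).

Lemma feval_all s (T : finType) (F : T -> form) :
  feval s (fall F) = [forall x, feval s (F x)].
Proof.
transitivity (all (fun x => feval s (F x)) (enum T)).
  by rewrite /fall; elim: (enum T) => //= x r ->.
by apply/allP/forallP => H x; [apply: H; rewrite mem_enum | move=> _; exact: H].
Qed.

Definition fimp (b : bool) f := if b then f else FTrue.

Lemma feval_imp s b f : feval s (fimp b f) = (b ==> feval s f).
Proof. by case: b. Qed.

Definition rsum (l : seq rexp) := foldr RAdd RZero l.
Definition rprod (l : seq rexp) := foldr RMul ROne l.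

Lemma reval_sum s I (r : seq I) F :
  reval s (rsum (map F r)) = \sum_(i <- r) reval s (F i).
Proof. by elim: r => [|i r IH] /=; rewrite ?big_nil ?big_cons ?IH. Qed.

Lemma reval_prod s I (r : seq I) F :
  reval s (rprod (map F r)) = \prod_(i <- r) reval s (F i).
Proof. by elim: r => [|i r IH] /=; rewrite ?big_nil ?big_cons ?IH. Qed.

(** The Leibniz sum, unrolled: its length depends only on [k], so its cost is constant in [n]. *)
Definition rdet k (A : 'I_k -> 'I_k -> rexp) :=
  rsum [seq RMul (if odd_perm sg then RSub RZero ROne else ROne)
                 (rprod [seq A i (sg i) | i <- enum 'I_k]) | sg <- enum 'S_k].

Lemma reval_det s k (A : 'I_k -> 'I_k -> rexp) :
  reval s (rdet A) = \det (\matrix_(i, j) reval s (A i j)).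
Proof.
rewrite /rdet reval_sum big_enum; apply: eq_bigr => sg _ /=; congr (_ * _).
  by case: odd_perm; rewrite /= ?sub0r.
by rewrite reval_prod big_enum; apply: eq_bigr => i _; rewrite mxE.
Qed.

Definition rgram (I : Type) k (y : I -> I -> rexp) o (f : 'I_k -> I) :=
  rdet (fun i j => RSub (RAdd (y o (f i)) (y o (f j))) (y (f i) (f j))).

Lemma reval_gram s (I : Type) k (y : I -> I -> rexp) o (f : 'I_k -> I) :
  reval s (rgram y o f) = \det (gram (fun i j => reval s (y i j)) o f).
Proof. exact: reval_det. Qed.

(** Naturals cannot be multiplied, so the address [u * m + k] is formed by adding [u] to 0 [m]
    times. *)
Definition point_coord m (u : iexp) k := RLoad (IAdd (iter m (IAdd u) (IConst 0)) (IConst k)).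

Definition rsqdist m (u v : iexp) :=
  rsum [seq let d := RSub (point_coord m u k) (point_coord m v k) in RMul d d | k <- iota 0 m].

Definition memdist m (r : nat -> R) (u v : nat) :=
  \sum_(k < m) (r (u * m + k)%N - r (v * m + k)%N) ^+ 2.

Lemma ieval_iter_add s k u c : ieval s (iter k (IAdd u) (IConst c)) = (ieval s u * k + c)%N.
Proof. by elim: k => [|k IH] /=; rewrite ?muln0 // IH mulnS addnA. Qed.

Lemma reval_sqdist s m u v :
  reval s (rsqdist m u v) = memdist m (rmem s) (ieval s u) (ieval s v).
Proof.
rewrite /rsqdist reval_sum /memdist -(big_mkord xpredT (fun k =>
  (rmem s (ieval s u * m + k)%N - rmem s (ieval s v * m + k)%N) ^+ 2)).
rewrite /index_iota subn0; apply: eq_bigr => k _.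
by rewrite /= !ieval_iter_add !addn0 expr2.
Qed.

Definition eval_edge s (e : iexp * iexp) := (ieval s e.1, ieval s e.2).

Definition fedge_eq (e f : iexp * iexp) :=
  FOr (FAnd (FTest (IEq e.1 f.1)) (FTest (IEq e.2 f.2)))
      (FAnd (FTest (IEq e.1 f.2)) (FTest (IEq e.2 f.1))).

Definition ftriangle (e f g : iexp * iexp) :=
  let at_apex c := FOr (FAnd (fedge_eq f (e.1, c)) (fedge_eq g (e.2, c)))
                       (FAnd (fedge_eq f (e.2, c)) (fedge_eq g (e.1, c))) in
  FOr (at_apex f.1) (at_apex f.2).

Lemma feval_triangle s e f g :
  feval s (ftriangle e f g) = triangle (eval_edge s e) (eval_edge s f) (eval_edge s g).
Proof. by rewrite /triangle /= orbF. Qed.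

Section Degenerate.
Variables (m : nat) (E : 'I_m.+2 -> 'I_m.+2 -> iexp * iexp).

Definition finjective :=
  FAnd (fall (fun i : 'I_m.+2 => fall (fun j : 'I_m.+2 =>
          fimp (i < j)%N (FNot (FTest (IEq (E i j).1 (E i j).2))))))
       (fall (fun i : 'I_m.+2 => fall (fun j : 'I_m.+2 =>
        fall (fun k : 'I_m.+2 => fall (fun l : 'I_m.+2 =>
          fimp [&& (i < j)%N, (k < l)%N & ~~ ((i == k) && (j == l))]
            (FNot (fedge_eq (E i j) (E k l)))))))).

Definition ftriangles :=
  fall (fun i : 'I_m.+2 => fall (fun j : 'I_m.+2 => fall (fun k : 'I_m.+2 =>
    fimp ((i < j)%N && (j < k)%N) (ftriangle (E i j) (E i k) (E j k))))).

Definition rpullback (i j : 'I_m.+2) :=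
  if i == j then RZero else
  if (i < j)%N then rsqdist m (E i j).1 (E i j).2 else rsqdist m (E j i).1 (E j i).2.

Definition fdegenerate :=
  FAnd finjective
    (FOr (FAnd ftriangles (FTest (REq (rgram rpullback ord0
            (fun i : 'I_m => lift ord0 (lift ord_max i))) RZero)))
         (FAnd (FNot ftriangles) (FTest (REq (rgram rpullback ord0 (lift ord0)) RZero)))).

Lemma feval_degenerate s : feval s fdegenerate =
  degenerate (memdist m (rmem s)) (fun i j => eval_edge s (E i j)).
Proof.
rewrite /degenerate /= /injective_assignment /preserves_triangles; congr (_ && _).
  rewrite !feval_all; congr (_ && _); apply: eq_forallb => i; rewrite feval_all;
    apply: eq_forallb => j; first by rewrite feval_imp.
  rewrite feval_all; apply: eq_forallb => k; rewrite feval_all; apply: eq_forallb => l.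
  rewrite feval_imp -[feval s _]/(~~ edge_eq (eval_edge s (E i j)) (eval_edge s (E k l))).
  by case: (i < j)%N; case: (k < l)%N; case: ((i == k) && (j == l)); case: (edge_eq _ _).
have -> : feval s ftriangles = preserves_triangles (fun i j => eval_edge s (E i j)).
  rewrite feval_all; apply: eq_forallb => i; rewrite feval_all; apply: eq_forallb => j.
  by rewrite feval_all; apply: eq_forallb => k; rewrite feval_imp feval_triangle.
have pE i j : reval s (rpullback i j) =
    pullback (memdist m (rmem s)) (fun i j => eval_edge s (E i j)) i j.
  rewrite /rpullback /pullback /sym_assignment; case: eqP => // _.
  by case: ifP => _; rewrite reval_sqdist.
rewrite !reval_gram /gram_base /gram_full !(eq_gram _ _ pE).
by rewrite -/(preserves_triangles _); case: preserves_triangles; rewrite /= ?orbF.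
Qed.

End Degenerate.

End Forms.

(** Room for the counters of every check, placed from cell 2 on, and for the cells 2 to 6 of the
    ranking. *)
Definition table_base m := (7 + 3 * m.+1 + 'C(m.+2, 2))%N.

(* Cell 1 records whether a check has failed; the cells from 2 up to
   [table_base m] are scratch; from there on, the endpoints of the edge of rank
   [k] are in the cells number [2 * k] and [2 * k + 1]. *)
Definition memory_is (R : realType) m n (r : nat -> R) (tab : nat -> nat) (b : bool) s :=
  [/\ rmem s = r, imem s 0 = n, forall k, imem s (table_base m + k) = tab k &
      imem s 1 = nat_of_bool b].

Definition check bnd f K :=
  nest bnd (branch f (IStore (IConst 1) (IConst 1)) Skip) 2 K.

Definition rank_test m :=
  FAnd (FTest (ILt (cell 4) (cell 5)))
       (FTest (RLt (rsqdist m (cell 4) (cell 5)) (rsqdist m (cell 2) (cell 3)))).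

Definition rank_program m :=
  Seq (IStore (IConst 6) (IConst 0))
    (nest (cell 0)
      (branch (rank_test m)
        (IStore (IConst 6) (IAdd (cell 6) (IConst 1))) Skip) 4 2).

Definition rank_cost m := (fcost (rank_test m) + 20)%N.

Definition fill_program m :=
  nest (cell 0)
    (branch (FTest (ILt (cell 2) (cell 3)))
      (Seq (rank_program m)
        (Seq (IStore (IAdd (IConst (table_base m)) (IAdd (cell 6) (cell 6))) (cell 2))
             (IStore (IAdd (IConst (table_base m).+1) (IAdd (cell 6) (cell 6))) (cell 3))))
      Skip) 2 2.

Lemma foldl_count (U : Type) (P : pred U) c (l : seq U) :
  foldl (fun c x => c + P x)%N c l = (c + count P l)%N.
Proof. by elim: l c => [|x l IH] c /=; rewrite ?addn0 // IH addnA. Qed.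

Lemma foldl_inv (S : Type) (U : eqType) (f : S -> U -> S) (P : S -> Prop) x (l : seq U) :
  P x -> (forall z u, u \in l -> P z -> P (f z u)) -> P (foldl f x l).
Proof.
elim: l x => //= u l IH x Px Pf; apply: IH; first by apply: Pf; rewrite ?mem_head.
by move=> z v vl; apply: Pf; rewrite inE vl orbT.
Qed.

Lemma imem_istore (R : realType) (s : state R) a w y :
  imem (istore s a w) y = if y == a then w else imem s y.
Proof. by []. Qed.

(** * Execution of the checks, ranking and the edge table *)

Section ProgramParts.
Variables (R : realType) (m n : nat) (r : nat -> R).
Local Notation tb := (table_base m).
Local Notation mem := (@memory_is R m n r).

Lemma memory_is_scratch tab b s y w : (1 < y < tb)%N -> mem tab b s -> mem tab b (istore s y w).
Proof.
move=> /andP[y1 ytb] [sr s0 st s1]; split => //=.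
- by case: eqP y1 => [<-|].
- by move=> k; case: eqP => [e|_]; [move: ytb; rewrite -e; lia | exact: st].
- by case: eqP y1 => [<-|].
Qed.

Lemma check_exec tab bnd f V K B : (2 + K <= tb)%N ->
  (forall s b, mem tab b s -> ieval s bnd = B) ->
  (forall s b l, mem tab b s -> l \in tuples K B ->
    (forall k, (k < K)%N -> imem s (2 + k) = nth 0%N l k) -> feval s f = V l) ->
  forall s b, mem tab b s -> exists s' t, [/\ exec (check bnd f K) s s' t,
    (t <= B.+2 ^ K * (fcost f + 3 + icost bnd + 9))%N &
    mem tab (b || has V (tuples K B)) s'].
Proof.
move=> Ktb sB sV s b sb.
have [| | |s' [t [e' tle sx']]] := @nest_exec R bool (branch f (IStore (IConst 1) (IConst 1)) Skip)
  bnd 2 K B (fcost f + 3) (fun s b => mem tab b s) (fun b l => b || V l) _ _ _ s b sb.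
- by move=> s1 b1 y w yK; apply: memory_is_scratch; lia.
- by move=> s1 b1; exact: sB.
- move=> s1 b1 l m1 lK s1l; have fV := sV _ _ _ m1 lK s1l.
  pose s2 := if V l then istore s1 1 1 else s1.
  have [|t e tle] := @exec_branch R f (IStore (IConst 1) (IConst 1)) Skip s1 s2
      (if V l then 3 else 1)%N.
    by rewrite fV /s2; case: (V l); [exact: exec_IStore | exact: exec_Skip].
  exists s2, t; split => //.
  + by apply: leq_trans tle _; rewrite leq_add2l; case: (V l).
  + rewrite /s2; case: (V l); rewrite ?orbF ?orbT //.
    by case: m1 => [? ? st ?]; split.
  + by move=> k kK; rewrite /s2; case: (V l).
exists s', t; split => //.
have -> : b || has V (tuples K B) = foldl (fun b l => b || V l) b (tuples K B) by
  elim: (tuples K B) (b) => [|l ls IH] b1 /=; rewrite ?orbF // -IH orbA.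
exact: sx'.
Qed.

Definition nat_rank i j := count (fun l =>
  (nth 0 l 0 < nth 0 l 1)%N && (memdist m r (nth 0%N l 0) (nth 0%N l 1) < memdist m r i j))
  (tuples 2 n).

Definition store_edge (tab : nat -> nat) (l : seq nat) : nat -> nat :=
  let: (i, j) := (nth 0%N l 0, nth 0%N l 1) in
  if (i < j)%N then fun k => if k == (nat_rank i j).*2.+1 then j
                             else if k == (nat_rank i j).*2 then i else tab k
  else tab.

Lemma rank_program_exec tab i j s : mem tab false s -> imem s 2 = i -> imem s 3 = j ->
  exists s' t, [/\ exec (rank_program m) s s' t, (t <= n.+2 ^ 2 * rank_cost m)%N &
    [/\ mem tab false s', imem s' 2 = i, imem s' 3 = j & imem s' 6 = nat_rank i j]].
Proof.
move=> ms s2 s3.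
pose inv (s : state R) c := [/\ mem tab false s, imem s 2 = i, imem s 3 = j & imem s 6 = c].
pose P l := (nth 0 l 0 < nth 0 l 1)%N &&
  (memdist m r (nth 0%N l 0) (nth 0%N l 1) < memdist m r i j).
pose s1 := istore s 6 0.
have [| | | |s' [t [e' tle sx']]] := @nest_exec R nat
  (branch (rank_test m) (IStore (IConst 6) (IAdd (cell 6) (IConst 1))) Skip) (cell 0) 4 2 n
  (fcost (rank_test m) + 6) inv (fun c l => c + P l)%N _ _ _ s1 0%N.
- move=> s0 x y w y46 [m0 s02 s03 s06]; split.
  + by apply: memory_is_scratch m0; rewrite /table_base; lia.
  + by rewrite imem_istore ifN //; lia.
  + by rewrite imem_istore ifN //; lia.
  + by rewrite imem_istore ifN //; lia.
- by move=> s0 x [[]].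
- move=> s0 c l [m0 s02 s03 s06] lK s0l.
  have fP : feval s0 (rank_test m) = P l.
    rewrite /P /rank_test [LHS]/= !reval_sqdist /= s02 s03 -(s0l 0%N) // -(s0l 1%N) //.
    by case: m0 => ->.
  pose s4 := if P l then istore s0 6 (imem s0 6 + 1)%N else s0.
  have [|t e tle] := @exec_branch R (rank_test m)
      (IStore (IConst 6) (IAdd (cell 6) (IConst 1))) Skip s0 s4 (if P l then 6 else 1)%N.
    by rewrite fP /s4; case: (P l); [exact: exec_IStore | exact: exec_Skip].
  exists s4, t; split => //.
  + by apply: leq_trans tle _; rewrite leq_add2l; case: (P l).
  + rewrite /s4; case: (P l); rewrite ?addn0 //; split => //.
    by rewrite imem_istore eqxx s06.
  + move=> k kK; rewrite /s4; case: (P l) => //; rewrite imem_istore ifN //; lia.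
- by [].
exists s', (3 + t)%N; split.
- apply: exec_Seq e'; exact: exec_IStore.
- by rewrite /rank_cost /= in tle *; nia.
case: sx' => ? ? ? s'6; split=> //; rewrite s'6 -[RHS]add0n.
exact: foldl_count.
Qed.

Lemma fill_program_exec s : mem (fun=> 0%N) false s ->
  exists s' t, [/\ exec (fill_program m) s s' t, (t <= n.+2 ^ 4 * (rank_cost m + 50))%N &
    mem (foldl store_edge (fun=> 0%N) (tuples 2 n)) false s'].
Proof.
move=> ms.
set put := Seq (IStore (IAdd (IConst (table_base m)) (IAdd (cell 6) (cell 6))) (cell 2))
             (IStore (IAdd (IConst (table_base m).+1) (IAdd (cell 6) (cell 6))) (cell 3)).
pose T := (n.+2 ^ 2 * rank_cost m + 30)%N.
have [| | | |s' [t [e' tle sx']]] := @nest_exec R (nat -> nat)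
  (branch (FTest (ILt (cell 2) (cell 3))) (Seq (rank_program m) put) Skip) (cell 0) 2 2 n
  T (fun s tab => mem tab false s) store_edge _ _ _ s (fun=> 0%N).
- by move=> s0 tab y w y24; apply: memory_is_scratch; rewrite /table_base; lia.
- by move=> s0 tab [].
- move=> s0 tab l m0 lK s0l.
  have l0 : imem s0 2 = nth 0%N l 0 by exact: (s0l 0%N).
  have l1 : imem s0 3 = nth 0%N l 1 by exact: (s0l 1%N).
  have [lt01|ge01] := boolP (nth 0 l 0 < nth 0 l 1)%N; last first.
    have [|t e tle] := @exec_branch R (FTest (ILt (cell 2) (cell 3)))
        (Seq (rank_program m) put) Skip s0 s0 1.
      by rewrite /= l0 l1 (negPf ge01); exact: exec_Skip.
    exists s0, t; split => //; first by rewrite /T /= in tle *; lia.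
    by rewrite /store_edge (negPf ge01).
  have [s1 [t1 [e1 t1le [m1 s12 s13 s16]]]] := rank_program_exec m0 l0 l1.
  pose rk := nat_rank (nth 0%N l 0) (nth 0%N l 1).
  pose s2 := istore s1 (tb + (rk + rk)) (nth 0%N l 0).
  pose s3 := istore s2 (tb.+1 + (rk + rk)) (nth 0%N l 1).
  have e2 : exec put s1 s3 (10 + 10).
    apply: (exec_Seq (s1 := s2)).
      have -> : s2 = istore s1 (ieval s1 (IAdd (IConst tb) (IAdd (cell 6) (cell 6))))
          (ieval s1 (cell 2)).
        by rewrite /s2 /rk -s16 -s12.
      exact: exec_IStore.
    have -> : s3 = istore s2 (ieval s2 (IAdd (IConst tb.+1) (IAdd (cell 6) (cell 6))))
        (ieval s2 (cell 3)).
      by rewrite /s3 /= s16 s13.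
    exact: exec_IStore.
  have [|t e tle] := @exec_branch R (FTest (ILt (cell 2) (cell 3)))
      (Seq (rank_program m) put) Skip s0 s3 (t1 + 20)%N.
    by rewrite /= l0 l1 lt01; exact: exec_Seq e1 e2.
  exists s3, t; split.
  + exact: e.
  + by rewrite /T /= in tle *; lia.
  + case: m1 => [s1r s10 s1t s11]; split => //.
    * move=> k; rewrite /s3 /s2 !imem_istore /store_edge lt01 -/rk s1t.
      have -> : (tb + k == tb.+1 + (rk + rk))%N = (k == rk.*2.+1) by apply/eqP/eqP; lia.
      by have -> : (tb + k == tb + (rk + rk))%N = (k == rk.*2) by apply/eqP/eqP; lia.
  + move=> [|[|//]] _; rewrite /s3 /s2 !imem_istore ?addn0 ?addn1.
      by rewrite [imem s1 _]s12 l0.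
    by rewrite [imem s1 _]s13 l1.
- exact: ms.
exists s', t; split => //; apply: leq_trans tle _.
rewrite /T; have := expn_gt0 n.+2 2; have -> : (n.+2 ^ 4 = n.+2 ^ 2 * n.+2 ^ 2)%N by rewrite -expnD.
by rewrite /=; nia.
Qed.

(** This holds even if edges share a rank, the last one written being kept. An untouched entry reads
    as the loop [(0, 0)], which no injective assignment uses. *)
Lemma table_entry k (tab := foldl store_edge (fun=> 0%N) (tuples 2 n)) :
  (tab k.*2 = 0%N /\ tab k.*2.+1 = 0%N) \/
  exists i j, [/\ (i < j < n)%N, nat_rank i j = k, tab k.*2 = i & tab k.*2.+1 = j].
Proof.
pose Q (tab : nat -> nat) := (tab k.*2 = 0%N /\ tab k.*2.+1 = 0%N) \/
  exists i j, [/\ (i < j < n)%N, nat_rank i j = k, tab k.*2 = i & tab k.*2.+1 = j].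
suff : Q tab by [].
apply: foldl_inv; first by left.
move=> t [|i [|j [|? ?]]]; rewrite mem_tuples //= => /and3P[iN jN _] Qt.
rewrite /store_edge /=; case: ifP => // ij.
have [rk|rk] := eqVneq (nat_rank i j) k.
  right; exists i, j; rewrite ij jN rk eqxx; split => //.
    by rewrite ifN ?eqxx //; lia.
  by rewrite eqxx.
have h1 : (k.*2 == (nat_rank i j).*2.+1) = false by lia.
have h2 : (k.*2 == (nat_rank i j).*2) = false.
  by apply/eqP => /double_inj/esym/eqP; rewrite (negPf rk).
have h3 : (k.*2.+1 == (nat_rank i j).*2.+1) = false by rewrite eqSS h2.
have h4 : (k.*2.+1 == (nat_rank i j).*2) = false by lia.
by rewrite /Q h1 h2 h3 h4.
Qed.

(** The entry written when the loops reach [[:: i; j]] is not overwritten, since no other edge has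
    its rank. *)
Lemma table_lookup i j (tab := foldl store_edge (fun=> 0%N) (tuples 2 n)) :
  (forall i' j', (i' < j' < n)%N -> nat_rank i' j' = nat_rank i j -> i' = i /\ j' = j) ->
  (i < j < n)%N -> tab (nat_rank i j).*2 = i /\ tab (nat_rank i j).*2.+1 = j.
Proof.
move=> rank_inj ijn.
pose Q (tab : nat -> nat) := tab (nat_rank i j).*2 = i /\ tab (nat_rank i j).*2.+1 = j.
have Qij t : Q (store_edge t [:: i; j]).
  case/andP: ijn => ij _; rewrite /Q /store_edge /= ij eqxx; split => //.
    by rewrite ifN ?eqxx //; lia.
  by rewrite eqxx.
have Qstep t l : l \in tuples 2 n -> Q t -> Q (store_edge t l).
  rewrite mem_tuples; case: l => [|i' [|j' [|? ?]]] //= /and3P[_ j'n _] Qt.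
  rewrite /store_edge /=; case: ifP => // ij'.
  have [rk|rk] := eqVneq (nat_rank i' j') (nat_rank i j).
    have [|-> ->] := rank_inj i' j' _ rk; first by rewrite ij'.
    by have := Qij t; rewrite /store_edge /=; case/andP: ijn => ->.
  have h1 : ((nat_rank i j).*2 == (nat_rank i' j').*2.+1) = false by lia.
  have h2 : ((nat_rank i j).*2 == (nat_rank i' j').*2) = false.
    by apply/eqP => /double_inj/esym/eqP; rewrite (negPf rk).
  have h3 : ((nat_rank i j).*2.+1 == (nat_rank i' j').*2.+1) = false by rewrite eqSS h2.
  have h4 : ((nat_rank i j).*2.+1 == (nat_rank i' j').*2) = false by lia.
  by rewrite /Q h1 h2 h3 h4.
have : [:: i; j] \in tuples 2 n.
  by rewrite mem_tuples /=; case/andP: ijn => ij jn; rewrite jn (ltn_trans ij jn).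
move=> ij_in; have [s1 [s2 sE]] : exists s1 s2, tuples 2 n = s1 ++ [:: i; j] :: s2.
  by move: (tuples 2 n) ij_in => s /splitPr[s1 s2]; exists s1, s2.
have : Q (foldl store_edge (fun=> 0%N) (s1 ++ [:: i; j] :: s2)).
  rewrite foldl_cat; apply: (@foldl_inv _ _ _ Q _ s2) => // t l ls; apply: Qstep.
  by rewrite sE mem_cat inE ls !orbT.
by rewrite -sE.
Qed.

End ProgramParts.

(** * Correctness of the decision procedure *)

Lemma eq_degenerate (R : ringType) m (T : eqType) (d : T -> T -> R)
    (psi psi' : 'I_m.+2 -> 'I_m.+2 -> T * T) :
  (forall i j : 'I_m.+2, (i < j)%N -> psi i j = psi' i j) ->
  degenerate d psi = degenerate d psi'.
Proof.
move=> psiE; have symE i j : i != j -> sym_assignment psi i j = sym_assignment psi' i j.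
  rewrite -(inj_eq val_inj) neq_ltn /sym_assignment.
  by case: ltnP => /= [ij _|_ ji]; exact: psiE.
have pE i j : pullback d psi i j = pullback d psi' i j.
  by rewrite /pullback; case: eqVneq => // ij; rewrite symE.
have iE : injective_assignment psi = injective_assignment psi'.
  congr (_ && _); apply: eq_forallb => i; apply: eq_forallb => j.
    by case: ltnP => //= ij; rewrite psiE.
  apply: eq_forallb => k; apply: eq_forallb => l.
  by case: ltnP => //= ij; case: ltnP => //= kl; rewrite !psiE.
have tE : preserves_triangles psi = preserves_triangles psi'.
  apply: eq_forallb => i; apply: eq_forallb => j; apply: eq_forallb => k.
  by case: ltnP => //= ij; case: ltnP => //= jk; rewrite !psiE // (ltn_trans ij).
by rewrite /degenerate iE tE /gram_base /gram_full !(eq_gram _ _ pE).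
Qed.

Lemma edge_eq_val n (e f : 'I_n * 'I_n) :
  edge_eq (val e.1, val e.2) (val f.1, val f.2) = edge_eq e f.
Proof. by case: e f => [a b] [c d]; rewrite /edge_eq !xpair_eqE /= !(inj_eq val_inj). Qed.

Lemma degenerate_val (R : ringType) m n (d : nat -> nat -> R) (d' : 'I_n -> 'I_n -> R)
    (psi : 'I_m.+2 -> 'I_m.+2 -> 'I_n * 'I_n) : (forall u v : 'I_n, d u v = d' u v) ->
  degenerate d (fun i j => (val (psi i j).1, val (psi i j).2)) = degenerate d' psi.
Proof.
move=> dE; have pE i j : pullback d (fun i j => (val (psi i j).1, val (psi i j).2)) i j =
    pullback d' psi i j.
  by rewrite /pullback /sym_assignment; case: eqP => // _; case: ifP => _; rewrite dE.
have iE : injective_assignment (fun i j => (val (psi i j).1, val (psi i j).2)) =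
    injective_assignment psi by [].
have tE : preserves_triangles (fun i j => (val (psi i j).1, val (psi i j).2)) =
    preserves_triangles psi.
  apply: eq_forallb => i; apply: eq_forallb => j; apply: eq_forallb => k.
  by rewrite /triangle /= -!(edge_eq_val _ (_, _)).
by rewrite /degenerate iE tE /gram_base /gram_full !(eq_gram _ _ pE).
Qed.

Definition slots m := enum [pred x : 'I_m.+2 * 'I_m.+2 | (x.1 < x.2)%N].

Lemma size_slots m : size (slots m) = 'C(m.+2, 2).
Proof. by rewrite -cardE card_ltn_pairs. Qed.

Lemma mem_slots m (i j : 'I_m.+2) : ((i, j) \in slots m) = (i < j)%N.
Proof. by rewrite mem_enum inE. Qed.

Definition coincidence_test m :=
  FAnd (FTest (ILt (cell 2) (cell 3))) (FAnd (FTest (ILt (cell 4) (cell 5)))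
    (FAnd (FNot (FAnd (FTest (IEq (cell 2) (cell 4))) (FTest (IEq (cell 3) (cell 5)))))
      (FTest (REq (rsqdist m (cell 2) (cell 3)) (rsqdist m (cell 4) (cell 5)))))).

(** Each counter is a rank, which the table turns into an edge. *)
Definition short_edge m (i j : 'I_m.+2) :=
  let k := cell (2 + index (i, j) (slots m)) in
  (ILoad (IAdd (IConst (table_base m)) (IAdd k k)),
   ILoad (IAdd (IConst (table_base m)) (IAdd (IConst 1) (IAdd k k)))).

(** The counters are the images of the first [m.+1] vertices, then the first ends and then the
    second ends of the edges to the last vertex. The constant pair is a default for [i = ord_max],
    where no [j] has [i < j]. *)
Definition based_edge m (i j : 'I_m.+2) :=
  match unlift ord_max i, unlift ord_max j with
  | Some i', Some j' => (cell (2 + i'), cell (2 + j'))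
  | Some i', None => (cell (2 + (m.+1 + i')), cell (2 + (2 * m.+1 + i')))
  | None, _ => (IConst 0, IConst 0)
  end.

(** The bound on ranks is a repeated sum of cell 0, which keeps [n] until the answer is stored
    there. *)
Definition generic_program m :=
  Seq (fill_program m)
    (Seq (check (cell 0) (coincidence_test m) 4)
      (Seq (check (cell 0) (fdegenerate (@based_edge m)) (3 * m.+1))
        (Seq (check (iter (packing_bound m) (IAdd (cell 0)) (IConst 0))
                (fdegenerate (@short_edge m)) 'C(m.+2, 2))
          (IStore (IConst 0) (ISub (IConst 1) (cell 1)))))).

Section Correctness.
Variables (R : realType) (m n : nat) (p : 'M[R]_(m, n)).
Local Notation r := (rmem (input p)).
Local Notation tab := (foldl (store_edge m n r) (fun=> 0%N) (tuples 2 n)).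

Lemma input_coord (k : 'I_m) (i : 'I_n) : r (i * m + k)%N = p k i.
Proof.
rewrite /=.
have H (s : seq 'I_n) (j : nat) : (j < size s)%N ->
    nth 0 [seq p k i | i <- s, k <- enum 'I_m] (j * m + k) = p k (nth i s j).
  elim: s j => [|x s IH] [|j] //= js; rewrite nth_cat size_map size_enum_ord.
    by rewrite mul0n add0n ltn_ord (nth_map k) ?size_enum_ord // nth_ord_enum.
  by rewrite ifN -?leqNgt mulSn -addnA ?leq_addr // addKn IH.
have := H (enum 'I_n) i; rewrite size_enum_ord => /(_ (ltn_ord i)) ->.
by rewrite nth_ord_enum.
Qed.

Lemma memdist_input (i j : 'I_n) : memdist m r i j = sqdist p i j.
Proof. by apply: eq_bigr => k _; rewrite !input_coord. Qed.

Lemma nat_rank_input (i j : 'I_n) : nat_rank m n r i j = edge_rank p (i, j).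
Proof.
have sum_iota (F : nat -> nat) : \sum_(a <- iota 0 n) F a = \sum_(a < n) F a.
  by rewrite -(big_mkord xpredT) /index_iota subn0.
rewrite /nat_rank -sum1_count /tuples big_mkcond big_allpairs_dep sum_iota.
rewrite /edge_rank -sum1_card -(pair_big_dep xpredT (fun a b : 'I_n => (a < b)%N &&
  (sqdist p a b < sqdist p i j)) (fun _ _ => 1%N)).
  apply: eq_bigr => a _; rewrite big_allpairs_dep sum_iota [RHS]big_mkcond.
by apply: eq_bigr => b _; rewrite big_seq1 /= !memdist_input.
Qed.

Definition coincidence l :=
  [&& (nth 0 l 0 < nth 0 l 1)%N, (nth 0 l 2 < nth 0 l 3)%N,
      ~~ ((nth 0 l 0 == nth 0 l 2)%N && (nth 0 l 1 == nth 0 l 3)%N) &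
      memdist m r (nth 0%N l 0) (nth 0%N l 1) == memdist m r (nth 0%N l 2) (nth 0%N l 3)].

Lemma has_coincidence : has coincidence (tuples 4 n) <-> ~ distinct_distances p.
Proof.
split=> [/hasP[l]|].
  rewrite mem_tuples; case: l => [|a [|b [|c [|d [|? ?]]]]] //= /and5P[an bn cn dn _].
  rewrite /coincidence /= => /and4P[ab cd abcd dE] D.
  have := D (Ordinal an, Ordinal bn) (Ordinal cn, Ordinal dn) ab cd.
  rewrite xpair_eqE -!(inj_eq val_inj) /= abcd -!memdist_input /= dE.
  by move=> /(_ isT).
move=> nD; apply/hasP; apply: contrapT => nV; apply: nD => [[a b] [c d]] /= ab cd abcd.
apply/negP => dE; apply: nV; exists [:: val a; val b; val c; val d].
  by rewrite mem_tuples /= !ltn_ord.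
rewrite /coincidence /= ab cd !memdist_input dE andbT /=.
by move: abcd; rewrite xpair_eqE -!(inj_eq val_inj).
Qed.

Definition short_values l (i j : 'I_m.+2) :=
  let k := nth 0%N l (index (i, j) (slots m)) in (tab k.*2, tab k.*2.+1).

Definition based_values l (i j : 'I_m.+2) :=
  match unlift ord_max i, unlift ord_max j with
  | Some i', Some j' => (nth 0 l i', nth 0 l j')%N
  | Some i', None => (nth 0 l (m.+1 + i'), nth 0 l (2 * m.+1 + i'))%N
  | None, _ => (0, 0)%N
  end.

Lemma has_based : (0 < n)%N ->
  has (fun l => degenerate (memdist m r) (based_values l)) (tuples (3 * m.+1) n) <->
  exists2 psi, based_assignment (@curry_ffun m n psi) & degenerate (sqdist p) (curry_ffun psi).
Proof.
move=> n0; split=> [/hasP[l]|[psi [b bE]]].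
  rewrite mem_tuples => /andP[/eqP lK /allP ln] dl.
  (* Since [n] is positive, the default 0 of [nth] is also the number of a point. *)
  have nth_n k : (nth 0 l k < n)%N.
    have [kl|lk] := ltnP k (size l); first by apply: ln; rewrite mem_nth.
    by rewrite nth_default.
  pose psi : {ffun 'I_m.+2 * 'I_m.+2 -> 'I_n * 'I_n} := [ffun e =>
    match unlift ord_max e.1, unlift ord_max e.2 with
    | Some i', Some j' => (Ordinal (nth_n i'), Ordinal (nth_n j'))
    | Some i', None => (Ordinal (nth_n (m.+1 + i')%N), Ordinal (nth_n (2 * m.+1 + i')%N))
    | None, _ => (Ordinal n0, Ordinal n0)
    end].
  exists psi.
    exists (fun i => Ordinal (nth_n i)) => i j _.
    by rewrite /curry_ffun ffunE /= !liftK.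
  rewrite -(degenerate_val _ memdist_input) -(eq_degenerate _ _ (psi := based_values l)) //.
  move=> i j _; rewrite /based_values /curry_ffun ffunE /=.
  by case: (unlift ord_max i) => // i'; case: (unlift ord_max j).
rewrite -(degenerate_val _ memdist_input) => dpsi.
pose e i := curry_ffun psi (lift ord_max i) ord_max.
pose l := [seq val (b i) | i <- enum 'I_m.+1] ++ [seq val (e i).1 | i <- enum 'I_m.+1] ++
  [seq val (e i).2 | i <- enum 'I_m.+1].
have size_enum (F : 'I_m.+1 -> nat) : size (map F (enum 'I_m.+1)) = m.+1.
  by rewrite size_map size_enum_ord.
apply/hasP; exists l.
  rewrite mem_tuples /l !size_cat !size_enum; apply/andP; split; first by apply/eqP; lia.
  by rewrite !all_cat !all_map; apply/and3P; split; apply/allP => i _ /=.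
have nth_map_enum (F : 'I_m.+1 -> nat) (i : 'I_m.+1) : nth 0%N (map F (enum 'I_m.+1)) i = F i.
  by rewrite (nth_map i) ?size_enum_ord // nth_ord_enum.
rewrite -(eq_degenerate _ _ (psi := fun i j =>
  (val (curry_ffun psi i j).1, val (curry_ffun psi i j).2))) //.
move=> i j; rewrite /based_values /l.
case: (unliftP ord_max i) => [i'|] -> ij; last first.
  by move: ij; rewrite ltnNge -ltnS ltn_ord.
case: (unliftP ord_max j) ij => [j'|] -> ij.
  rewrite !nth_cat !size_enum !ltn_ord !nth_map_enum bE //.
  by move: ij; rewrite !lift_max.
rewrite -/(e i') !nth_cat !size_enum.
have -> : (m.+1 + i' < m.+1)%N = false by lia.
have -> : (m.+1 + i' - m.+1)%N = i' by lia.
have -> : (2 * m.+1 + i' < m.+1)%N = false by lia.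
have -> : (2 * m.+1 + i' - m.+1 < m.+1)%N = false by lia.
have -> : (2 * m.+1 + i' - m.+1 - m.+1)%N = i' by lia.
by rewrite ltn_ord !nth_map_enum.
Qed.

Lemma edge_rank_inj (e f : 'I_n * 'I_n) : distinct_distances p ->
  (e.1 < e.2)%N -> (f.1 < f.2)%N -> edge_rank p e = edge_rank p f -> e = f.
Proof.
have lt_rank (a b : 'I_n * 'I_n) : (a.1 < a.2)%N ->
    sqdist p a.1 a.2 < sqdist p b.1 b.2 -> (edge_rank p a < edge_rank p b)%N.
  move=> a12 ab; apply/proper_card/properP; split.
    by apply/fintype.subsetP => c; rewrite !inE => /andP[-> /lt_trans->].
  by exists a; rewrite !inE a12 ?ab ?ltxx.
move=> D e12 f12 ef; apply/eqP/negPn/negP => /(D _ _ e12 f12).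
by rewrite neq_lt => /orP[/lt_rank|/lt_rank] h; [have := h e12|have := h f12]; rewrite ef ltnn.
Qed.

Lemma has_short : (0 < n)%N -> distinct_distances p ->
  has (fun l => degenerate (memdist m r) (short_values l))
    (tuples 'C(m.+2, 2) (n * packing_bound m)) <->
  exists2 psi, short_assignment p (@curry_ffun m n psi) & degenerate (sqdist p) (curry_ffun psi).
Proof.
move=> n0 D; split=> [/hasP[l]|[psi sh]].
  rewrite mem_tuples => /andP[/eqP lK /allP ln] dl.
  have entry (x : 'I_m.+2 * 'I_m.+2) : exists e : 'I_n * 'I_n, (x.1 < x.2)%N ->
     [/\ (e.1 < e.2)%N, short_values l x.1 x.2 = (val e.1, val e.2) &
         (edge_rank p e < packing_bound m * n)%N].
    case: x => i j /=; have [ij|_] := ltnP i j; last by exists (Ordinal n0, Ordinal n0).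
    (* Injectivity rules out untouched table entries. *)
    have : (short_values l i j).1 != (short_values l i j).2.
      case/andP: dl => /andP[/forallP/(_ i)/forallP/(_ j)/implyP dl _] _; exact: dl.
    rewrite /short_values; set k := nth _ _ _ => /= k12.
    have [[k1 k2]|[a [b [/andP[ab bn] rab k1 k2]]]] := table_entry m n r k.
      by move: k12; rewrite k1 k2.
    have an := ltn_trans ab bn.
    exists (Ordinal an, Ordinal bn) => _ /=; rewrite k1 k2; split => //.
    rewrite -nat_rank_input rab mulnC; apply: ln; rewrite mem_nth // lK -size_slots index_mem.
    by rewrite mem_slots.
  have [f fE] := choice entry.
  pose psi : {ffun 'I_m.+2 * 'I_m.+2 -> 'I_n * 'I_n} := [ffun x => f x].
  exists psi; first by move=> i j ij; rewrite /curry_ffun ffunE; have [] := fE (i, j) ij.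
  rewrite -(degenerate_val _ memdist_input) -(eq_degenerate _ (psi := short_values l)) //.
  by move=> i j ij; rewrite /curry_ffun ffunE; have [] := fE (i, j) ij.
rewrite -(degenerate_val _ memdist_input) => dpsi.
pose l := [seq edge_rank p (psi x) | x <- slots m].
apply/hasP; exists l.
  rewrite mem_tuples size_map size_slots eqxx /=; apply/allP => k /mapP[[i j]].
  by rewrite mem_slots => ij ->; rewrite mulnC; have [] := sh i j ij.
rewrite -(eq_degenerate _ (psi := fun i j =>
  (val (curry_ffun psi i j).1, val (curry_ffun psi i j).2))) //.
move=> i j ij; rewrite /short_values /l (nth_map (i, j)) ?index_mem ?mem_slots //.
rewrite nth_index ?mem_slots // -/(curry_ffun psi i j); set e := curry_ffun psi i j.
have [e12 _] := sh i j ij; rewrite -/e in e12.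
rewrite (surjective_pairing e) -nat_rank_input -surjective_pairing.
have [||-> -> //] := @table_lookup R m n r e.1 e.2; last by rewrite e12 ltn_ord.
move=> a b /andP[ab bn]; have an := ltn_trans ab bn.
rewrite (nat_rank_input (Ordinal an) (Ordinal bn)) nat_rank_input.
by move/edge_rank_inj => /(_ D ab e12) eE; rewrite -(surjective_pairing e) in eE; rewrite -eE.
Qed.

Definition failure : bool :=
  [|| has coincidence (tuples 4 n),
      has (fun l => degenerate (memdist m r) (based_values l)) (tuples (3 * m.+1) n) |
      has (fun l => degenerate (memdist m r) (short_values l))
        (tuples 'C(m.+2, 2) (n * packing_bound m))].

(** The check of short assignments is meaningful for distinct distances; in the other case the
    coincidence check already reports a failure. *)
Lemma failureP : (0 < n)%N -> failure = ~~ `[< generic p >].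
Proof.
move=> n0; apply/idP/idP.
  move=> fail; apply/asboolPn => -[D gen]; move: fail.
  case/or3P => [/has_coincidence|/(has_based n0)[psi bpsi]|/(has_short n0 D)[psi spsi]].
  - exact.
  - by apply/negP/gen; right.
  - by apply/negP/gen; left.
move=> /asboolPn ngen; apply: contra_notT ngen; rewrite !negb_or => /and3P[nc nb ns].
have D : distinct_distances p by apply: contrapT => /has_coincidence; rewrite (negPf nc).
split => // psi [spsi|bpsi]; apply/negP => deg.
  by move/negP: ns; apply; apply/has_short => //; exists psi.
by move/negP: nb; apply; apply/has_based => //; exists psi.
Qed.

Lemma generic_program_exec : (0 < n)%N -> exists s t,
  [/\ exec (generic_program m) (input p) s t, imem s 0 = nat_of_bool `[< generic p >] &
  (t <= n.+2 ^ 4 * (rank_cost m + 50) +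
       (n.+2 ^ 4 * (fcost (coincidence_test m) + 3 + icost (cell 0) + 9) +
       (n.+2 ^ (3 * m.+1) * (fcost (fdegenerate (@based_edge m)) + 3 + icost (cell 0) + 9) +
       ((n * packing_bound m).+2 ^ 'C(m.+2, 2) * (fcost (fdegenerate (@short_edge m)) + 3 +
          icost (iter (packing_bound m) (IAdd (cell 0)) (IConst 0)) + 9) + 6))))%N].
Proof.
move=> n0.
have mem0 : memory_is m n r (fun=> 0%N) false (input p) by split.
have [s1 [t1 [e1 t1le m1]]] := fill_program_exec mem0.
have [| | |s2 [t2 [e2 t2le m2]]] := check_exec (bnd := cell 0) (f := coincidence_test m)
  (V := coincidence) (K := 4) (B := n) _ _ _ m1.
- by rewrite /table_base; lia.
- by move=> s b [].
- move=> s b l [sr _ _ _] _ sl; rewrite /coincidence /= !reval_sqdist sr /=.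
  by rewrite -(sl 0%N) // -(sl 1%N) // -(sl 2%N) // -(sl 3%N).
have [| | |s3 [t3 [e3 t3le m3]]] := check_exec (bnd := cell 0) (f := fdegenerate (@based_edge m))
  (V := fun l => degenerate (memdist m r) (based_values l)) (K := (3 * m.+1)%N) (B := n) _ _ _ m2.
- by rewrite /table_base; lia.
- by move=> s b [].
- move=> s b l [sr _ _ _] _ sl; rewrite feval_degenerate sr; apply: eq_degenerate => i j ij.
  rewrite /based_edge /based_values.
  case: (unliftP ord_max i) => [i'|] iE; last by move: ij; rewrite iE ltnNge -ltnS ltn_ord.
  have i'm := ltn_ord i'.
  case: (unliftP ord_max j) => [j'|] _; rewrite /eval_edge; last by congr (_, _); apply: sl; lia.
  by have j'm := ltn_ord j'; congr (_, _); apply: sl; lia.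
have [| | |s4 [t4 [e4 t4le m4]]] := check_exec
  (bnd := iter (packing_bound m) (IAdd (cell 0)) (IConst 0)) (f := fdegenerate (@short_edge m))
  (V := fun l => degenerate (memdist m r) (short_values l)) (K := 'C(m.+2, 2))
  (B := (n * packing_bound m)%N) _ _ _ m3.
- by rewrite /table_base; lia.
- by move=> s b [_ sn _ _]; rewrite ieval_iter_add /= sn addn0.
- move=> s b l [sr _ st _] _ sl; rewrite feval_degenerate sr; apply: eq_degenerate => i j ij.
  have idx : (index (i, j) (slots m) < 'C(m.+2, 2))%N by rewrite -size_slots index_mem mem_slots.
  pose c := cell (2 + index (i, j) (slots m)).
  have cE : ieval s c = nth 0%N l (index (i, j) (slots m)) by exact: sl.
  transitivity (imem s (table_base m + (ieval s c + ieval s c)),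
      imem s (table_base m + (1 + (ieval s c + ieval s c)))); first by [].
  by rewrite cE !st addnn add1n.
set s5 := istore s4 0 (1 - imem s4 1).
have e5 : exec (IStore (IConst 0) (ISub (IConst 1) (cell 1))) s4 s5 6 by exact: exec_IStore.
exists s5; eexists; split.
- exact: exec_Seq e1 (exec_Seq e2 (exec_Seq e3 (exec_Seq e4 e5))).
- case: m4 => _ _ _ s41; rewrite /s5 imem_istore eqxx s41.
  by rewrite -[X in nat_of_bool X]/(_ || _) orFb -!orbA -/failure failureP //; case: asbool.
- by do !apply: leq_add.
Qed.

End Correctness.

(** For positive [n], [n * a + 2 <= (a + 2) * n], which separates the constants from the power of
    [n]. *)
Lemma leq_powers n a b k e : (0 < n)%N -> (k <= e)%N ->
  ((n * a).+2 ^ k * b <= a.+2 ^ k * b * n ^ e)%N.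
Proof.
move=> n0 ke; rewrite mulnAC leq_mul2r; apply/orP; right.
apply: (@leq_trans (a.+2 ^ k * n ^ k)); last by rewrite leq_mul2l leq_pexp2l // orbT.
rewrite -expnMn; case: (posnP k) => [->|k0]; first by rewrite !expn0.
by rewrite leq_exp2r //; nia.
Qed.

(* The exponent is exact: m ^ 2 + 3 * m + 12 is always even. *)
Theorem proposition4p1 (R : realType) (m : nat) :
  exists Omega : forall n : nat, set 'M[R]_(m, n),
    (forall n : nat, (m + 2 <= n)%N ->
       [/\ open (Omega n), dense (Omega n) &
           forall p : 'M[R]_(m, n), not_all_equal p -> Omega n p ->
             determined_by_rescaled_distances p]) /\
    (exists (P : program) (C : nat), forall n : nat, (m + 2 <= n)%N ->
       decides_within P (Omega n)
         (C * n ^ ((m ^ 2 + 3 * m + 12) %/ 2))%N).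
Proof.
(* R^0 is a single point, so no configuration has points that are not all equal, and the program may
   answer 1 at once. *)
have [->|m0] := posnP m.
  exists (fun n => setT); split.
    move=> n _; split; first exact: openT.
    - by move=> O [p Op] _; exists p.
    - move=> p [i [j []]]; by apply/colP => -[].
  exists (IStore (IConst 0) (IConst 1)), 3%N => n n2 p.
  exists (istore (input p) 0 1), 3%N; split; first exact: exec_IStore.
    by rewrite leq_pmulr // expn_gt0; case: n n2 p.
  by rewrite imem_istore eqxx; case: asboolP => // -[].
set e := ((m ^ 2 + 3 * m + 12) %/ 2)%N.
have cE : (2 * 'C(m.+2, 2) = m.+2 * m.+1)%N by rewrite -mul_bin_diag bin1.
(* [m ^ 2 + 3 * m + 12 = (m + 2) * (m + 1) + 10]. *)
have eE : e = ('C(m.+2, 2) + 5)%N.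
  rewrite /e (_ : m ^ 2 + 3 * m + 12 = 2 * ('C(m.+2, 2) + 5))%N ?mulKn //.
  by rewrite mulnDr cE -mulnn; lia.
have e4 : (4 <= e)%N by rewrite eE; lia.
have eA : ('C(m.+2, 2) <= e)%N by rewrite eE leq_addr.
(* Twice the difference is [m ^ 2 - 3 * m + 6], which is positive. *)
have eB : (3 * m.+1 <= e)%N by rewrite eE; nia.
exists (fun n => @generic R m n); split.
  move=> n; rewrite addn2 => mn; split; first exact: generic_open.
    exact: generic_dense.
  by move=> p pne pgen; exact: generic_determined.
pose cost (f : form) (b : iexp) := (fcost f + 3 + icost b + 9)%N.
pose short_bound := iter (packing_bound m) (IAdd (cell 0)) (IConst 0).
exists (generic_program m), (3 ^ 4 * (rank_cost m + 50) +
  (3 ^ 4 * cost (coincidence_test m) (cell 0) +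
  (3 ^ (3 * m.+1) * cost (fdegenerate (@based_edge m)) (cell 0) +
  ((packing_bound m).+2 ^ 'C(m.+2, 2) * cost (fdegenerate (@short_edge m)) short_bound + 6))))%N.
move=> n; rewrite addn2 => mn p; have n0 : (0 < n)%N by apply: leq_trans mn.
have [s [t [est s0 tle]]] := generic_program_exec p n0.
exists s, t; split => //; apply: leq_trans tle _.
(* The powers of 3 in the constant come from [n + 2 <= 3 * n]. *)
have power k b : (k <= e)%N -> (n.+2 ^ k * b <= 3 ^ k * b * n ^ e)%N.
  by move=> ke; have := leq_powers 1 b n0 ke; rewrite muln1.
rewrite !mulnDl; do 3 (apply: leq_add; first exact: power).
apply: leq_add; first exact: leq_powers.
by rewrite leq_pmulr // expn_gt0 n0.
Qed.
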